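(* Let $p\not\equiv0$ be a smooth two-phase solution of the focusing NLS equation with non-singular spectral curve, whose branch points are $\lambda_1=\lambda_2^*=r_1+is_1$, $\lambda_3=\lambda_4^*=r_2+is_2$, $\lambda_5=\lambda_6^*=r_3+is_3$ with $r_j\in\mathbb R$ and $0<s_1\le s_2\le s_3$. Then $$\sup_{(x,t)\in\mathbb R^2}|p(x,t)|=s_1+s_2+s_3,$$ and $$\inf_{(x,t)\in\mathbb R^2}|p(x,t)|=\begin{cases}s_3-s_1-s_2,& s_3>s_1+s_2,\\ 0,& s_3\le s_1+s_2.\end{cases}$$ (Equivalently $|p|^2=\nu_1$ oscillates between $(s_1+s_2+s_3)^2$ and $(s_1+s_2-s_3)^2$ or $0$, respectively.)
   Context: Let $p(x,t)$, $(x,t)\in\mathbb R^2$, be a smooth complex-valued solution of the focusing nonlinear Schrödinger equation $ip_t+p_{xx}+2|p|^2p=0$; $^*$ denotes complex conjugation and subscripts denote partial derivatives. Put $\mathbb U=\begin{pmatrix}-i\lambda& ip\\ ip^*& i\lambda\end{pmatrix}$ and $\mathbb V=\begin{pmatrix}-2i\lambda^2+i|p|^2& 2i\lambda p-p_x\\ 2i\lambda p^*+p^*_x& 2i\lambda^2-i|p|^2\end{pmatrix}$. The solution $p$ is called a two-phase solution if there exist real constants $c_0,c_1,c_2$ such that the matrix $\Psi=\begin{pmatrix}\Psi_{11}&\Psi_{12}\\ \Psi_{21}&-\Psi_{11}\end{pmatrix}$ with $\Psi_{11}=-i\lambda^3-ic_2\lambda^2+(\tfrac12 i|p|^2-ic_1)\lambda+\tfrac14(pp^*_x-p_xp^*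 )+\tfrac12 ic_2|p|^2-ic_0$, $\Psi_{12}=ip\lambda^2+(-\tfrac12p_x+ic_2p)\lambda-\tfrac14 ip_{xx}-\tfrac12 ip|p|^2-\tfrac12c_2p_x+ic_1p$, $\Psi_{21}=ip^*\lambda^2+(\tfrac12p^*_x+ic_2p^* )\lambda-\tfrac14 ip^*_{xx}-\tfrac12 ip^*|p|^2+\tfrac12c_2p^*_x+ic_1p^*$ satisfies $\Psi_x=[\mathbb U,\Psi]$ and $\Psi_t=[\mathbb V,\Psi]$ identically in $\lambda\in\mathbb C$. The polynomial $\mathscr R(\lambda)=-\Psi_{11}^2-\Psi_{12}\Psi_{21}$ is monic of degree 6 and independent of $(x,t)$; its roots $\lambda_1,\dots,\lambda_6$ are the branch points of the spectral curve $w^2=\mathscr R(\lambda)$, which is non-singular if they are pairwise distinct (in which case they necessarily form three complex-conjugate pairs for such $p$). *)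

(* Defs.v *)
(* classical reals. Complex numbers are modelled as pairs of reals. *)
From Stdlib Require Import Reals List.
Open Scope R_scope.

(** * Complex numbers *)
Record Cplx := mkC { Re : R; Im : R }.

Definition RtoC (a : R) : Cplx := mkC a 0.
Definition Ci : Cplx := mkC 0 1.
Definition Cadd (z w : Cplx) : Cplx := mkC (Re z + Re w) (Im z + Im w).
Definition Copp (z : Cplx) : Cplx := mkC (- Re z) (- Im z).
Definition Csub (z w : Cplx) : Cplx := Cadd z (Copp w).
Definition Cmul (z w : Cplx) : Cplx :=
  mkC (Re z * Re w - Im z * Im w) (Re z * Im w + Im z * Re w).
Definition Cconj (z : Cplx) : Cplx := mkC (Re z) (- Im z).
(** |z|^2 and |z| *)
Definition Cnorm2 (z : Cplx) : R := Re z * Re z + Im z * Im z.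
Definition Cabs (z : Cplx) : R := sqrt (Cnorm2 z).

Declare Scope Cplx_scope.
Delimit Scope Cplx_scope with C.
Infix "+" := Cadd : Cplx_scope.
Infix "-" := Csub : Cplx_scope.
Infix "*" := Cmul : Cplx_scope.
Notation "- z" := (Copp z) : Cplx_scope.
Notation "z ^*" := (Cconj z) (at level 2, format "z ^*") : Cplx_scope.

(** Finite product of complex numbers over a list. *)
Definition Cprod (l : list Cplx) : Cplx := fold_right Cmul (RtoC 1) l.

(** * Calculus for complex-valued functions *)

(** g : R -> Cplx has derivative l at x (real and imaginary parts). *)
Definition Cderiv (g : R -> Cplx) (x : R) (l : Cplx) : Prop :=
  derivable_pt_lim (fun y => Re (g y)) x (Re l) /\
  derivable_pt_lim (fun y => Im (g y)) x (Im l).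

(** Joint continuity of f : R^2 -> Cplx. *)
Definition Ccont2 (f : R -> R -> Cplx) : Prop :=
  forall x t eps, 0 < eps -> exists delta, 0 < delta /\
    forall x' t', Rabs (x' - x) < delta -> Rabs (t' - t) < delta ->
      Cabs (Csub (f x' t') (f x t)) < eps.

(** [D] is the family of partial derivatives of [p]:
    D i j = d^i/dx^i d^j/dt^j p, all of them existing and jointly continuous.
    [p] is smooth (Cplx^infinity) iff such a family exists, and then the family
    is unique; so universally quantifying over such D is the same as
    speaking of the partial derivatives of a smooth p. *)
Definition smooth_family (p : R -> R -> Cplx) (D : nat -> nat -> R -> R -> Cplx) : Prop :=
  (forall x t, D 0%nat 0%nat x t = p x t) /\
  (forall i j, Ccont2 (D i j)) /\
  (forall i j x t, Cderiv (fun y => D i j y t) x (D (S i) j x t)) /\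
  (forall i j x t, Cderiv (fun s => D i j x s) t (D i (S j) x t)).

(** Focusing NLS:  i p_t + p_xx + 2|p|^2 p = 0. *)
Definition focusing_NLS (D : nat -> nat -> R -> R -> Cplx) : Prop :=
  forall x t,
    ((Ci * D 0%nat 1%nat x t) + D 2%nat 0%nat x t
      + (RtoC (2 * Cnorm2 (D 0%nat 0%nat x t)) * D 0%nat 0%nat x t))%C = RtoC 0.

(** * 2x2 complex matrices *)
Record M2 := mkM2 { m11 : Cplx; m12 : Cplx; m21 : Cplx; m22 : Cplx }.

Definition M2mul (A B : M2) : M2 :=
  mkM2 (m11 A * m11 B + m12 A * m21 B)%C (m11 A * m12 B + m12 A * m22 B)%C
       (m21 A * m11 B + m22 A * m21 B)%C (m21 A * m12 B + m22 A * m22 B)%C.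
Definition M2sub (A B : M2) : M2 :=
  mkM2 (m11 A - m11 B)%C (m12 A - m12 B)%C (m21 A - m21 B)%C (m22 A - m22 B)%C.
(** commutator [A, B] = AB - BA *)
Definition M2comm (A B : M2) : M2 := M2sub (M2mul A B) (M2mul B A).

(** Derivative of a matrix-valued function, entrywise. *)
Definition M2deriv (G : R -> M2) (x : R) (L : M2) : Prop :=
  Cderiv (fun y => m11 (G y)) x (m11 L) /\ Cderiv (fun y => m12 (G y)) x (m12 L) /\
  Cderiv (fun y => m21 (G y)) x (m21 L) /\ Cderiv (fun y => m22 (G y)) x (m22 L).

Section LaxMatrices.
Local Open Scope Cplx_scope.

(** U(λ) at (x,t) *)
Definition Umat (D : nat -> nat -> R -> R -> Cplx) (lam : Cplx) (x t : R) : M2 :=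
  let p := D 0%nat 0%nat x t in
  mkM2 (- (Ci * lam)) (Ci * p) (Ci * p^*) (Ci * lam).

(** V(λ) at (x,t) *)
Definition Vmat (D : nat -> nat -> R -> R -> Cplx) (lam : Cplx) (x t : R) : M2 :=
  let p := D 0%nat 0%nat x t in
  let px := D 1%nat 0%nat x t in
  let n := RtoC (Cnorm2 p) in
  mkM2 (- (RtoC 2 * Ci * lam * lam) + Ci * n)
       (RtoC 2 * Ci * lam * p - px)
       (RtoC 2 * Ci * lam * p^* + px^*)
       (RtoC 2 * Ci * lam * lam - Ci * n).

Definition Psi11 (D : nat -> nat -> R -> R -> Cplx) (c0 c1 c2 : R) (lam : Cplx) (x t : R) : Cplx :=
  let p := D 0%nat 0%nat x t in
  let px := D 1%nat 0%nat x t in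
  let n := RtoC (Cnorm2 p) in
  - (Ci * lam * lam * lam) - Ci * RtoC c2 * lam * lam
  + (RtoC (1/2) * Ci * n - Ci * RtoC c1) * lam
  + RtoC (1/4) * (p * px^* - px * p^*)
  + RtoC (1/2) * Ci * RtoC c2 * n - Ci * RtoC c0.

Definition Psi12 (D : nat -> nat -> R -> R -> Cplx) (c0 c1 c2 : R) (lam : Cplx) (x t : R) : Cplx :=
  let p := D 0%nat 0%nat x t in
  let px := D 1%nat 0%nat x t in
  let pxx := D 2%nat 0%nat x t in
  let n := RtoC (Cnorm2 p) in
  Ci * p * lam * lam + (- (RtoC (1/2) * px) + Ci * RtoC c2 * p) * lam
  - RtoC (1/4) * Ci * pxx - RtoC (1/2) * Ci * p * n
  - RtoC (1/2) * RtoC c2 * px + Ci * RtoC c1 * p.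

Definition Psi21 (D : nat -> nat -> R -> R -> Cplx) (c0 c1 c2 : R) (lam : Cplx) (x t : R) : Cplx :=
  let p := D 0%nat 0%nat x t in
  let px := D 1%nat 0%nat x t in
  let pxx := D 2%nat 0%nat x t in
  let n := RtoC (Cnorm2 p) in
  Ci * p^* * lam * lam + (RtoC (1/2) * px^* + Ci * RtoC c2 * p^*) * lam
  - RtoC (1/4) * Ci * pxx^* - RtoC (1/2) * Ci * p^* * n
  + RtoC (1/2) * RtoC c2 * px^* + Ci * RtoC c1 * p^*.

Definition Psimat (D : nat -> nat -> R -> R -> Cplx) (c0 c1 c2 : R) (lam : Cplx) (x t : R) : M2 :=
  mkM2 (Psi11 D c0 c1 c2 lam x t) (Psi12 D c0 c1 c2 lam x t)
       (Psi21 D c0 c1 c2 lam x t) (- Psi11 D c0 c1 c2 lam x t).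

(** The spectral polynomial R(λ) = -Ψ11^2 - Ψ12 Ψ21 (a priori depending on (x,t)). *)
Definition spec_poly (D : nat -> nat -> R -> R -> Cplx) (c0 c1 c2 : R) (lam : Cplx) (x t : R) : Cplx :=
  - (Psi11 D c0 c1 c2 lam x t * Psi11 D c0 c1 c2 lam x t)
  - Psi12 D c0 c1 c2 lam x t * Psi21 D c0 c1 c2 lam x t.

End LaxMatrices.

(** Two-phase condition with the given constants c0, c1, c2:
    Ψ_x = [U, Ψ] and Ψ_t = [V, Ψ] identically in λ ∈ Cplx. *)
Definition two_phase_with (D : nat -> nat -> R -> R -> Cplx) (c0 c1 c2 : R) : Prop :=
  forall (lam : Cplx) (x t : R),
    M2deriv (fun y => Psimat D c0 c1 c2 lam y t) x
            (M2comm (Umat D lam x t) (Psimat D c0 c1 c2 lam x t)) /\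
    M2deriv (fun s => Psimat D c0 c1 c2 lam x s) t
            (M2comm (Vmat D lam x t) (Psimat D c0 c1 c2 lam x t)).

(** Infimum (greatest lower bound) of a set of reals. *)
Definition is_glb (E : R -> Prop) (m : R) : Prop :=
  (forall y, E y -> m <= y) /\ (forall b, (forall y, E y -> b <= y) -> b <= m).

(* Main.v *)
(** The isospectral states (p, p_x, p_xx) form a bounded set on which the x- and t-flows are
    polynomial.  Along a sequence of points where |p|^2 tends to its supremum or infimum, the
    states accumulate at one where the gradient of |p|^2 vanishes and its Hessian is semidefinite,
    because third derivatives are uniformly bounded.  If p <> 0 there, then after a phase rotation
    -i Psi12 = Q and i Psi11 = P are real polynomials with leading coefficients a = |p| and 1, so
    that R = P^2 + Q^2 = (P + i Q)(P - i Q) and P + i Q has one root r_j - i t_j, t_j = s_j or -s_j,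
    from each conjugate pair of branch points.  Hence a = t_1 + t_2 + t_3, and everything else is
    determined by the r_j and t_j; the Hessian determinant in (x, t) turns out to be
      256 a t_1 t_2 t_3 prod_(j<k) ((r_j - r_k)^2 + (t_j + t_k)^2).
    It is nonzero and its semidefiniteness forces t_1 t_2 t_3 > 0, leaving the values
    s_1 + s_2 + s_3 and s_3 - s_1 - s_2; both are taken since |p| cannot be constant.
    Finally p = 0 can occur only when R - P^2 is a quadratic of nonpositive discriminant, and
    that discriminant is a negative multiple of
    (s_1 + s_2 + s_3)(s_2 + s_3 - s_1)(s_1 + s_3 - s_2)(s_1 + s_2 - s_3). *)
Require Import Defs.
From Stdlib Require Import Reals List Lra Lia Ring Classical IndefiniteDescription.
Import ListNotations.
Open Scope R_scope.

(** * Polynomial identities *)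

(** Six distinct sample points determine a polynomial of degree at most 5. Both sides of the
    spectral identities are monic sextics, so their difference has this form. *)
Lemma poly5_zero (k0 k1 k2 k3 k4 k5 : R) :
  (forall l, k5 * l ^ 5 + k4 * l ^ 4 + k3 * l ^ 3 + k2 * l ^ 2 + k1 * l + k0 = 0) ->
  k0 = 0 /\ k1 = 0 /\ k2 = 0 /\ k3 = 0 /\ k4 = 0 /\ k5 = 0.
Proof.
intros H.
pose proof (H 0) as H0; pose proof (H 1) as H1; pose proof (H (-1)) as H2.
pose proof (H 2) as H3; pose proof (H (-2)) as H4; pose proof (H 3) as H5.
repeat split; lra.
Qed.

Definition spec_real (r1 r2 r3 s1 s2 s3 l : R) : R :=
  ((l - r1) ^ 2 + s1 ^ 2) * ((l - r2) ^ 2 + s2 ^ 2) * ((l - r3) ^ 2 + s3 ^ 2).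

(** For p = 0, Psi12 restricted to real arguments is a complex affine function. *)
Lemma node_impossible (c0 c1 c2 l1 l0 m1 m0 r1 r2 r3 s1 s2 s3 : R) :
  0 < s1 -> 0 < s2 -> 0 < s3 ->
  (forall l, (l ^ 3 + c2 * l ^ 2 + c1 * l + c0) ^ 2 + (l1 * l + l0) ^ 2 + (m1 * l + m0) ^ 2
     = spec_real r1 r2 r3 s1 s2 s3 l) ->
  s3 <= s1 + s2.
Proof.
intros h1 h2 h3 H; unfold spec_real in H.
(* [R5], ..., [R0] are the lower coefficients of [spec_real]. *)
pose (R5 := - 2 * (r1 + r2 + r3)).
pose (n1 := r1 ^ 2 + s1 ^ 2); pose (n2 := r2 ^ 2 + s2 ^ 2); pose (n3 := r3 ^ 2 + s3 ^ 2).
pose (R4 := n1 + n2 + n3 + 4 * (r1 * r2 + r1 * r3 + r2 * r3)).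
pose (R3 := - 2 * (r1 * (n2 + n3) + r2 * (n1 + n3) + r3 * (n1 + n2)) - 8 * r1 * r2 * r3).
pose (R2 := n1 * n2 + n1 * n3 + n2 * n3 + 4 * (r1 * r2 * n3 + r1 * r3 * n2 + r2 * r3 * n1)).
pose (R1 := - 2 * (r1 * n2 * n3 + r2 * n1 * n3 + r3 * n1 * n2)).
pose (R0 := n1 * n2 * n3).
destruct (poly5_zero (c0 ^ 2 + l0 ^ 2 + m0 ^ 2 - R0)
  (2 * c1 * c0 + 2 * l1 * l0 + 2 * m1 * m0 - R1)
  (c1 ^ 2 + 2 * c2 * c0 + l1 ^ 2 + m1 ^ 2 - R2)
  (2 * c0 + 2 * c1 * c2 - R3) (2 * c1 + c2 ^ 2 - R4) (2 * c2 - R5))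
  as (E0 & E1 & E2 & E3 & E4 & E5).
{ intros l; pose proof (H l) as Hl.
  transitivity ((l ^ 3 + c2 * l ^ 2 + c1 * l + c0) ^ 2 + (l1 * l + l0) ^ 2 + (m1 * l + m0) ^ 2
   - ((l - r1) ^ 2 + s1 ^ 2) * ((l - r2) ^ 2 + s2 ^ 2) * ((l - r3) ^ 2 + s3 ^ 2)); [|lra].
  unfold R0, R1, R2, R3, R4, R5, n1, n2, n3; ring. }
assert (c2 = R5 / 2) as F2 by lra.
assert (c1 = (R4 - c2 ^ 2) / 2) as F1 by lra.
assert (c0 = (R3 - 2 * c1 * c2) / 2) as F0 by lra.
assert (l1 ^ 2 + m1 ^ 2 = R2 - 2 * c2 * c0 - c1 ^ 2) as G2 by lra.
assert (2 * (l1 * l0 + m1 * m0) = R1 - 2 * c1 * c0) as G1 by lra.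
assert (l0 ^ 2 + m0 ^ 2 = R0 - c0 ^ 2) as G0 by lra.
(* Cauchy-Schwarz for the vectors (l1, m1) and (l0, m0), through Lagrange's identity. *)
assert (0 <= 4 * (l1 ^ 2 + m1 ^ 2) * (l0 ^ 2 + m0 ^ 2) - (2 * (l1 * l0 + m1 * m0)) ^ 2) as CS.
{ replace (4 * (l1 ^ 2 + m1 ^ 2) * (l0 ^ 2 + m0 ^ 2) - (2 * (l1 * l0 + m1 * m0)) ^ 2)
    with (4 * (l1 * m0 - l0 * m1) ^ 2) by ring.
  pose proof (pow2_ge_0 (l1 * m0 - l0 * m1)); lra. }
rewrite G0, G1, G2 in CS.
(* The cofactor left when the Heron product of s1, s2, s3 is divided out of the quantity bounded by
   [CS]. Its last term keeps it positive even if real parts coincide. *)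
pose (W := ((r1 - r2) * (r1 - r3) * (r2 - r3)) ^ 2
  + (s1 * (r1 - r2) * (r1 - r3)) ^ 2 + (s2 * (r1 - r2) * (r2 - r3)) ^ 2
  + (s3 * (r1 - r3) * (r2 - r3)) ^ 2
  + (s1 * s2 * (r1 - r2)) ^ 2 + (s1 * s3 * (r1 - r3)) ^ 2 + (s2 * s3 * (r2 - r3)) ^ 2
  + (s1 * s2 * s3) ^ 2).
assert (0 < W) as HW.
{ unfold W.
  assert (0 < (s1 * s2 * s3) ^ 2) by (apply pow_lt; repeat apply Rmult_lt_0_compat; assumption).
  repeat match goal with |- context [?a ^ 2] =>
    lazymatch a with s1 * s2 * s3 => fail | _ =>
     let x := fresh "x" in pose proof (pow2_ge_0 a); set (x := a ^ 2) in * end end.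
  lra. }
assert (4 * (R2 - 2 * c2 * c0 - c1 ^ 2) * (R0 - c0 ^ 2) - (R1 - 2 * c1 * c0) ^ 2
  = W * ((s1 + s2 + s3) * (s2 + s3 - s1) * (s1 + s3 - s2) * (s1 + s2 - s3))) as EQ.
{ rewrite F0, F1, F2; unfold R0, R1, R2, R3, R4, R5, n1, n2, n3, W; field. }
rewrite EQ in CS.
destruct (Rle_or_lt s3 (s1 + s2)) as [|L]; [assumption|exfalso].
assert (0 < W * ((s1 + s2 + s3) * (s2 + s3 - s1) * (s1 + s3 - s2) * (s3 - s1 - s2))).
{ repeat apply Rmult_lt_0_compat; lra. }
lra.
Qed.

(** Second derivatives of |p|^2 at a critical point with p = a > 0, p_x = i b and p_xx = d. *)
Definition hxx (a b d : R) := 2 * a * d + 2 * b ^ 2.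
Definition hxt (a b d c0 c1 c2 : R) :=
  12 * a ^ 3 * b - 8 * a ^ 4 * c2 + 2 * b * d - 8 * a * b * c1 - 4 * a * d * c2 + 16 * a ^ 2 * c0.
Definition htt (a b d c0 c1 c2 : R) :=
  16*a^4*c2^2 -16*a^3*b*c2 + 4*a^3*d -8*a^2*b^2 -32*a^2*c0*c2 -16*a*b*c0 + 16*a*b*c1*c2 -8*a*d*c1 + 8*a*d*c2^2 + 2*d^2.

(** The hypotheses solve P + i Q = prod (l - r_j + i t_j) coefficientwise for the state a, b, d and
    the constants c0, c1, c2. *)
Lemma hess_det (r1 r2 r3 t1 t2 t3 a b d c0 c1 c2 : R) :
  a = t1 + t2 + t3 -> c2 = - (r1 + r2 + r3) ->
  c1 = r1 * r2 + r1 * r3 + r2 * r3 - (t1 * t2 + t1 * t3 + t2 * t3) + a ^ 2 / 2 ->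
  b = 2 * (c2 * a + (r1 * t2 + r1 * t3 + r2 * t1 + r2 * t3 + r3 * t1 + r3 * t2)) ->
  c0 = - (r1 * r2 * r3 - r1 * t2 * t3 - r2 * t1 * t3 - r3 * t1 * t2) - a * b / 2 + c2 * a ^ 2 / 2 ->
  d = 4 * (- (r1 * r2 * t3 + r1 * r3 * t2 + r2 * r3 * t1 - t1 * t2 * t3) - a ^ 3 / 2 - c2 * b / 2 + c1 * a) ->
  hxx a b d * htt a b d c0 c1 c2 - hxt a b d c0 c1 c2 ^ 2 =
  256 * (a * (t1 * t2 * t3)) * (((r1 - r2) ^ 2 + (t1 + t2) ^ 2) * ((r1 - r3) ^ 2 + (t1 + t3) ^ 2)
   * ((r2 - r3) ^ 2 + (t2 + t3) ^ 2)).
Proof.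
intros -> -> -> -> -> ->; unfold hxx, hxt, htt.
field.
Qed.

(** * Complex roots of P + i Q and the admissible critical values *)

Lemma Cplx_eq (z w : Cplx) : Re z = Re w -> Im z = Im w -> z = w.
Proof. destruct z, w; cbn; intros -> ->; reflexivity. Qed.

Lemma Cplx_ring : ring_theory (RtoC 0) (RtoC 1) Cadd Cmul Csub Copp eq.
Proof. constructor; intros; apply Cplx_eq; cbn; ring. Qed.
Add Ring Cplx_ring_instance : Cplx_ring.

Lemma Cmul_integral (z w : Cplx) : Cmul z w = RtoC 0 -> z = RtoC 0 \/ w = RtoC 0.
Proof.
destruct z as [a b], w as [c d]; unfold Cmul, RtoC; cbn; intros [= H1 H2].
assert ((a * a + b * b) * (c * c + d * d) = 0) as H.
{ replace ((a * a + b * b) * (c * c + d * d)) with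
    ((a * c - b * d) * (a * c - b * d) + (a * d + b * c) * (a * d + b * c)) by ring.
  rewrite H1, H2; ring. }
apply Rmult_integral in H as [H | H]; [left | right]; apply Cplx_eq; cbn; nra.
Qed.

Lemma Csub_eq0 (z w : Cplx) : Csub z w = RtoC 0 -> z = w.
Proof. intros H; replace z with (Cadd (Csub z w) w) by ring; rewrite H; ring. Qed.

(** Vieta's formulas by divided differences: subtracting the equations at two distinct roots and
    cancelling the difference of the roots lowers the degree, and doing so twice isolates [A2]. *)
Lemma monic_cubic_roots (A2 A1 A0 b1 b2 b3 : Cplx) :
  b1 <> b2 -> b1 <> b3 -> b2 <> b3 ->
  (forall b, b = b1 \/ b = b2 \/ b = b3 ->
     b * b * b + A2 * (b * b) + A1 * b + A0 = RtoC 0)%C ->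
  (A2 = - (b1 + b2 + b3) /\ A1 = b1 * b2 + b1 * b3 + b2 * b3 /\ A0 = - (b1 * b2 * b3))%C.
Proof.
intros n12 n13 n23 H.
pose proof (H b1 (or_introl eq_refl)) as H1.
pose proof (H b2 (or_intror (or_introl eq_refl))) as H2.
pose proof (H b3 (or_intror (or_intror eq_refl))) as H3.
assert (forall x y, x <> y -> x * x * x + A2 * (x * x) + A1 * x + A0 = RtoC 0 ->
   y * y * y + A2 * (y * y) + A1 * y + A0 = RtoC 0 ->
   x * x + x * y + y * y + A2 * (x + y) + A1 = RtoC 0)%C as K.
{ intros x y nxy Hx Hy.
  destruct (Cmul_integral (x - y)%C (x * x + x * y + y * y + A2 * (x + y) + A1)%C) as [E|E]; trivial.
  - transitivity ((x * x * x + A2 * (x * x) + A1 * x + A0)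
      - (y * y * y + A2 * (y * y) + A1 * y + A0))%C; [ring | rewrite Hx, Hy; ring].
  - exfalso; apply nxy, Csub_eq0, E. }
pose proof (K _ _ n12 H1 H2) as K12; pose proof (K _ _ n13 H1 H3) as K13.
assert (A2 = - (b1 + b2 + b3))%C as E2.
{ destruct (Cmul_integral (b2 - b3)%C (A2 + (b1 + b2 + b3))%C) as [E|E].
  - transitivity ((b1 * b1 + b1 * b2 + b2 * b2 + A2 * (b1 + b2) + A1)
      - (b1 * b1 + b1 * b3 + b3 * b3 + A2 * (b1 + b3) + A1))%C; [ring | rewrite K12, K13; ring].
  - exfalso; apply n23, Csub_eq0, E.
  - replace A2 with (A2 + (b1 + b2 + b3) - (b1 + b2 + b3))%C by ring; rewrite E; ring. }
assert (A1 = b1 * b2 + b1 * b3 + b2 * b3)%C as E1.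
{ transitivity (b1 * b1 + b1 * b2 + b2 * b2 + A2 * (b1 + b2) + A1
   - (b1 * b1 + b1 * b2 + b2 * b2 + A2 * (b1 + b2)))%C; [ring|].
  rewrite K12, E2; ring. }
repeat split; trivial.
transitivity (b1 * b1 * b1 + A2 * (b1 * b1) + A1 * b1 + A0
  - (b1 * b1 * b1 + A2 * (b1 * b1) + A1 * b1))%C; [ring|].
rewrite H1, E2, E1; ring.
Qed.

(** Since R = (P + i Q)(P - i Q), at each branch point one factor vanishes, so P + i Q has a root in
    each conjugate pair. The signs of the t_j are not known beforehand, so distinctness is assumed
    for all of them. *)
Lemma sum_squares_factor (A2 A1 A0 q2 q1 q0 r1 r2 r3 s1 s2 s3 : R) :
  (forall r t r' t', (r = r1 /\ t ^ 2 = s1 ^ 2 /\ r' = r2 /\ t' ^ 2 = s2 ^ 2 \/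
     r = r1 /\ t ^ 2 = s1 ^ 2 /\ r' = r3 /\ t' ^ 2 = s3 ^ 2 \/
     r = r2 /\ t ^ 2 = s2 ^ 2 /\ r' = r3 /\ t' ^ 2 = s3 ^ 2) -> mkC r t <> mkC r' t') ->
  (forall l, (l ^ 3 + A2 * l ^ 2 + A1 * l + A0) ^ 2 + (q2 * l ^ 2 + q1 * l + q0) ^ 2
     = spec_real r1 r2 r3 s1 s2 s3 l) ->
  exists t1 t2 t3, t1 ^ 2 = s1 ^ 2 /\ t2 ^ 2 = s2 ^ 2 /\ t3 ^ 2 = s3 ^ 2 /\
   q2 = t1 + t2 + t3 /\ A2 = - (r1 + r2 + r3) /\
   A1 = r1 * r2 + r1 * r3 + r2 * r3 - (t1 * t2 + t1 * t3 + t2 * t3) /\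
   q1 = - (r1 * t2 + r1 * t3 + r2 * t1 + r2 * t3 + r3 * t1 + r3 * t2) /\
   A0 = - (r1 * r2 * r3 - r1 * t2 * t3 - r2 * t1 * t3 - r3 * t1 * t2) /\
   q0 = r1 * r2 * t3 + r1 * r3 * t2 + r2 * r3 * t1 - t1 * t2 * t3.
Proof.
intros dist H; unfold spec_real in H.
pose (n1 := r1 ^ 2 + s1 ^ 2); pose (n2 := r2 ^ 2 + s2 ^ 2); pose (n3 := r3 ^ 2 + s3 ^ 2).
pose (R5 := - 2 * (r1 + r2 + r3)).
pose (R4 := n1 + n2 + n3 + 4 * (r1 * r2 + r1 * r3 + r2 * r3)).
pose (R3 := - 2 * (r1 * (n2 + n3) + r2 * (n1 + n3) + r3 * (n1 + n2)) - 8 * r1 * r2 * r3).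
pose (R2 := n1 * n2 + n1 * n3 + n2 * n3 + 4 * (r1 * r2 * n3 + r1 * r3 * n2 + r2 * r3 * n1)).
pose (R1 := - 2 * (r1 * n2 * n3 + r2 * n1 * n3 + r3 * n1 * n2)).
pose (R0 := n1 * n2 * n3).
destruct (poly5_zero (A0 ^ 2 + q0 ^ 2 - R0) (2 * A1 * A0 + 2 * q1 * q0 - R1)
  (A1 ^ 2 + 2 * A2 * A0 + q1 ^ 2 + 2 * q2 * q0 - R2)
  (2 * A0 + 2 * A1 * A2 + 2 * q2 * q1 - R3) (2 * A1 + A2 ^ 2 + q2 ^ 2 - R4) (2 * A2 - R5))
  as (E0 & E1 & E2 & E3 & E4 & E5).
{ intros l; pose proof (H l) as Hl.
  transitivity ((l ^ 3 + A2 * l ^ 2 + A1 * l + A0) ^ 2 + (q2 * l ^ 2 + q1 * l + q0) ^ 2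
   - ((l - r1) ^ 2 + s1 ^ 2) * ((l - r2) ^ 2 + s2 ^ 2) * ((l - r3) ^ 2 + s3 ^ 2)); [|lra].
  unfold R0, R1, R2, R3, R4, R5, n1, n2, n3; ring. }
(* [B] is P + i Q. As P and Q are real, the conjugate of [B] at the conjugate of z is P - i Q at
   z. *)
pose (B := fun z : Cplx =>
  (z * z * z + mkC A2 q2 * (z * z) + mkC A1 q1 * z + mkC A0 q0)%C).
assert (forall r s, (r = r1 /\ s = s1 \/ r = r2 /\ s = s2 \/ r = r3 /\ s = s3) ->
  exists t, t ^ 2 = s ^ 2 /\ B (mkC r (- t)) = RtoC 0) as root.
{ intros r s rs.
  assert (Cmul (B (mkC r s)) (Cconj (B (mkC r (- s)))) = RtoC 0) as Z.
  { pose (z := mkC r s).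
    assert (forall c k, RtoC (c - k) = RtoC c - RtoC k)%C as sub
      by (intros; apply Cplx_eq; cbn; ring).
    (* The discrepancies of the coefficients are kept as explicit terms, so that this is an identity
       of polynomials; [E0] to [E5] then remove them. *)
    transitivity ((z * z - RtoC (2 * r1) * z + RtoC n1) * (z * z - RtoC (2 * r2) * z + RtoC n2)
       * (z * z - RtoC (2 * r3) * z + RtoC n3)
       + RtoC (2 * A2 - R5) * (z * z * z * z * z) + RtoC (2 * A1 + A2 ^ 2 + q2 ^ 2 - R4) * (z * z * z * z)
       + RtoC (2 * A0 + 2 * A1 * A2 + 2 * q2 * q1 - R3) * (z * z * z)
       + RtoC (A1 ^ 2 + 2 * A2 * A0 + q1 ^ 2 + 2 * q2 * q0 - R2) * (z * z)
       + RtoC (2 * A1 * A0 + 2 * q1 * q0 - R1) * z + RtoC (A0 ^ 2 + q0 ^ 2 - R0))%C.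
    - unfold B, z, R5, R4, R3, R2, R1, R0; clearbody n1 n2 n3; apply Cplx_eq; cbn; ring.
    - rewrite E0, E1, E2, E3, E4, E5.
      assert ((z * z - RtoC (2 * r1) * z + RtoC n1) * (z * z - RtoC (2 * r2) * z + RtoC n2)
       * (z * z - RtoC (2 * r3) * z + RtoC n3) = RtoC 0)%C as ->; [|ring].
      assert (forall r' s', r = r' -> s = s' ->
        z * z - RtoC (2 * r') * z + RtoC (r' ^ 2 + s' ^ 2) = RtoC 0)%C as van
        by (intros ? ? <- <-; apply Cplx_eq; cbn; ring).
      destruct rs as [[h h'] | [[h h'] | [h h']]]; unfold n1, n2, n3; rewrite (van _ _ h h'); ring. }
  apply Cmul_integral in Z as [Z | Z].
  - exists (- s); split; [ring | rewrite Ropp_involutive; exact Z].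
  - exists s; split; trivial.
    injection Z as Z1 Z2; apply Cplx_eq; cbn in *; lra. }
destruct (root r1 s1) as (t1 & h1 & z1); auto.
destruct (root r2 s2) as (t2 & h2 & z2); auto.
destruct (root r3 s3) as (t3 & h3 & z3); auto 6.
assert (forall t s, t ^ 2 = s ^ 2 -> (- t) ^ 2 = s ^ 2) as sgn
  by (intros t s <-; ring).
destruct (monic_cubic_roots (mkC A2 q2) (mkC A1 q1) (mkC A0 q0)
  (mkC r1 (- t1)) (mkC r2 (- t2)) (mkC r3 (- t3))) as (F2 & F1 & F0).
- apply dist; left; auto.
- apply dist; right; left; auto.
- apply dist; right; right; auto.
- intros b [-> | [-> | ->]]; assumption.
- injection F2 as F2 F2'; injection F1 as F1 F1'; injection F0 as F0 F0'.
  exists t1, t2, t3; repeat split; trivial; lra.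
Qed.

Lemma pow2_gt_0 (x : R) : x <> 0 -> 0 < x ^ 2.
Proof. intros h; rewrite <- Rsqr_pow2; apply Rsqr_pos_lt, h. Qed.

(** By [hess_det] the sign of the determinant is that of t_1 t_2 t_3, so an even number of the t_j
    is negative. Of the four choices, a > 0 and the ordering of the s_j leave only two. *)
Lemma critical_value (a b d c0 c1 c2 r1 r2 r3 s1 s2 s3 : R) :
  0 < a -> 0 < s1 -> s1 <= s2 -> s2 <= s3 ->
  NoDup [mkC r1 s1; mkC r1 (- s1); mkC r2 s2; mkC r2 (- s2); mkC r3 s3; mkC r3 (- s3)] ->
  (forall l, (l ^ 3 + c2 * l ^ 2 + (c1 - a ^ 2 / 2) * l + (c0 - c2 * a ^ 2 / 2 + a * b / 2)) ^ 2
     + (a * l ^ 2 + (c2 * a - b / 2) * l + (c1 * a - d / 4 - a ^ 3 / 2 - c2 * b / 2)) ^ 2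
     = spec_real r1 r2 r3 s1 s2 s3 l) ->
  0 <= hxx a b d * htt a b d c0 c1 c2 - hxt a b d c0 c1 c2 ^ 2 ->
  (a = s1 + s2 + s3 \/ a = s3 - s1 - s2) /\
  hxx a b d * htt a b d c0 c1 c2 - hxt a b d c0 c1 c2 ^ 2 <> 0.
Proof.
intros ha h1 h12 h23 nd H pos.
assert (forall x y : R, x ^ 2 = y ^ 2 -> x = y \/ x = - y) as sq.
{ intros x y E; assert ((x - y) * (x + y) = 0) as E' by (ring_simplify; lra).
  apply Rmult_integral in E' as [E' | E']; [left | right]; lra. }
assert (forall r t r' t', (r = r1 /\ t ^ 2 = s1 ^ 2 /\ r' = r2 /\ t' ^ 2 = s2 ^ 2 \/
     r = r1 /\ t ^ 2 = s1 ^ 2 /\ r' = r3 /\ t' ^ 2 = s3 ^ 2 \/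
     r = r2 /\ t ^ 2 = s2 ^ 2 /\ r' = r3 /\ t' ^ 2 = s3 ^ 2) -> mkC r t <> mkC r' t') as dist.
{ repeat rewrite NoDup_cons_iff in nd; cbn in nd.
  intros r t r' t' [(-> & q & -> & q') | [(-> & q & -> & q') | (-> & q & -> & q')]] E;
  apply sq in q as [-> | ->]; apply sq in q' as [-> | ->];
  intuition congruence. }
destruct (sum_squares_factor _ _ _ _ _ _ _ _ _ _ _ _ dist H)
  as (t1 & t2 & t3 & q1 & q2 & q3 & F1 & F2 & F3 & F4 & F5 & F6).
assert (forall x y r r' s s', (r = r1 /\ x ^ 2 = s1 ^ 2 /\ r' = r2 /\ y ^ 2 = s2 ^ 2 \/
     r = r1 /\ x ^ 2 = s1 ^ 2 /\ r' = r3 /\ y ^ 2 = s3 ^ 2 \/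
     r = r2 /\ x ^ 2 = s2 ^ 2 /\ r' = r3 /\ y ^ 2 = s3 ^ 2) ->
    s = x -> s' = y -> 0 < (r - r') ^ 2 + (s + s') ^ 2) as pd.
(* The sum of squares is the squared distance between r + i x and r' - i y, which are distinct
   branch points. *)
{ intros x y r r' s s' h -> ->.
  assert (mkC r x <> mkC r' (- y)) as ne.
  { apply dist; replace ((- y) ^ 2) with (y ^ 2) by ring; exact h. }
  pose proof (pow2_ge_0 (r - r')); pose proof (pow2_ge_0 (x + y)).
  destruct (Req_dec (r - r') 0) as [e|e].
  - destruct (Req_dec (x + y) 0) as [e'|e'].
    + exfalso; apply ne; f_equal; lra.
    + pose proof (pow2_gt_0 _ e'); lra.
  - pose proof (pow2_gt_0 _ e); lra. }
pose proof (hess_det r1 r2 r3 t1 t2 t3 a b d c0 c1 c2) as HD.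
rewrite HD in * by (lra || (rewrite <- F1; lra)); clear HD.
match goal with |- _ /\ 256 * _ * ?x <> 0 => set (X := x) in *; assert (0 < X) as hX end.
{ unfold X; repeat apply Rmult_lt_0_compat; eapply pd; try reflexivity; auto 10. }
clearbody X.
assert (0 < s1 * s2 * s3) as hs by (repeat apply Rmult_lt_0_compat; lra).
assert (0 < 256 * (a * (s1 * s2 * s3)) * X) as hp by (repeat apply Rmult_lt_0_compat; lra).
apply sq in q1, q2, q3.
assert (t1 * t2 * t3 = s1 * s2 * s3 \/ t1 * t2 * t3 = - (s1 * s2 * s3)) as [e | e].
{ destruct q1 as [-> | ->], q2 as [-> | ->], q3 as [-> | ->];
    (left; ring) || (right; ring). }
- rewrite e; split; [|lra].
  destruct q1 as [-> | ->], q2 as [-> | ->], q3 as [-> | ->];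
    first [left; lra | right; lra | exfalso; lra].
- exfalso; rewrite e in pos; lra.
Qed.

(** * Calculus along lines and compactness *)

Lemma Rabs_le_inv (x y : R) : Rabs x <= y -> - y <= x <= y.
Proof. unfold Rabs; destruct (Rcase_abs x); lra. Qed.

Definition cont2 (f : R -> R -> R) := forall x t eps, 0 < eps -> exists delta, 0 < delta /\
  forall x' t', Rabs (x' - x) < delta -> Rabs (t' - t) < delta -> Rabs (f x' t' - f x t) < eps.

Lemma increment_bound (f f' : R -> R) (a b l eps : R) :
  (forall y, derivable_pt_lim f y (f' y)) ->
  (forall c, Rmin a b <= c <= Rmax a b -> Rabs (f' c - l) <= eps) ->
  Rabs (f b - f a - l * (b - a)) <= eps * Rabs (b - a).
Proof.
intros df H.
destruct (MVT_abs (fun y => f y - l * y) (fun y => f' y - l) a b) as (c & E & hc).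
- intros c _; apply (derivable_pt_lim_minus f (fun y => l * y)); [apply df|].
  pose proof (derivable_pt_lim_scal id l c 1 (derivable_pt_lim_id c)) as q.
  rewrite Rmult_1_r in q; exact q.
- replace (f b - f a - l * (b - a)) with (f b - l * b - (f a - l * a)) by ring.
  rewrite E; apply Rmult_le_compat_r; [apply Rabs_pos | auto].
Qed.

(** The increment is split into a step in x followed by a step in t, and [increment_bound] compares
    each with its partial derivative at the base point. *)
Lemma line_derivative (f fx ft : R -> R -> R) (x t al be h0 : R) :
  (forall x t, derivable_pt_lim (fun y => f y t) x (fx x t)) ->
  (forall x t, derivable_pt_lim (fun y => f x y) t (ft x t)) ->
  cont2 fx -> cont2 ft ->
  derivable_pt_lim (fun h => f (x + al * h) (t + be * h)) h0
    (al * fx (x + al * h0) (t + be * h0) + be * ft (x + al * h0) (t + be * h0)).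
Proof.
intros Dx Dt cx ct eps heps.
set (X := x + al * h0); set (T := t + be * h0).
(* [K] bounds both slopes, and the summand 1 keeps it positive when both vanish. *)
pose (K := Rabs al + Rabs be + 1).
assert (Rabs al >= 0 /\ Rabs be >= 0) as [ha hb] by (split; apply Rle_ge, Rabs_pos).
assert (0 < K) as hK by (unfold K; lra).
assert (0 < eps / (2 * K)) as he by (apply Rdiv_lt_0_compat; lra).
destruct (cx X T _ he) as (d1 & hd1 & H1), (ct X T _ he) as (d2 & hd2 & H2).
assert (0 < Rmin d1 d2 / K) as hd by (apply Rdiv_lt_0_compat; [apply Rmin_pos|]; lra).
exists (mkposreal _ hd); cbn; intros h hn hh.
replace (x + al * (h0 + h)) with (X + al * h) by (unfold X; ring).
replace (t + be * (h0 + h)) with (T + be * h) by (unfold T; ring).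
assert (Rabs h * K < Rmin d1 d2) as hh'.
{ apply (Rmult_lt_compat_r K) in hh; trivial; field_simplify in hh; lra. }
pose proof (Rabs_pos_lt _ hn) as hp.
assert (forall c k y, Rabs c <= K -> Rmin k (k + c * h) <= y <= Rmax k (k + c * h) ->
   Rabs (y - k) < Rmin d1 d2) as near.
{ intros c k y hc hy; apply Rle_lt_trans with (Rabs (c * h)).
  - revert hy; unfold Rmin, Rmax, Rabs; destruct (Rle_dec k (k + c * h));
      destruct (Rcase_abs (y - k)), (Rcase_abs (c * h)); lra.
  - rewrite Rabs_mult; apply Rle_lt_trans with (Rabs h * K); trivial.
    rewrite Rmult_comm; apply Rmult_le_compat_l; lra. }
assert (Rabs al <= K /\ Rabs be <= K) as [ka kb] by (unfold K; lra).
pose proof (Rmin_l d1 d2); pose proof (Rmin_r d1 d2).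
assert (Rabs (f (X + al * h) (T + be * h) - f X (T + be * h) - fx X T * (X + al * h - X))
   <= eps / (2 * K) * Rabs (X + al * h - X)) as I1.
{ apply (increment_bound (fun y => f y (T + be * h)) (fun y => fx y (T + be * h))).
  - intros y; apply Dx.
  - intros c hc; apply Rlt_le, H1.
    + apply (near al) in hc; trivial; lra.
    + apply Rlt_le_trans with (Rmin d1 d2); trivial; apply (near be); trivial.
      split; [apply Rmin_r | apply Rmax_r]. }
assert (Rabs (f X (T + be * h) - f X T - ft X T * (T + be * h - T))
   <= eps / (2 * K) * Rabs (T + be * h - T)) as I2.
{ apply (increment_bound (fun y => f X y) (fun y => ft X y)).
  - intros y; apply Dt.
  - intros c hc; apply Rlt_le, H2.
    + rewrite Rminus_diag, Rabs_R0; trivial.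
    + apply (near be) in hc; trivial; lra. }
replace (X + al * h - X) with (al * h) in I1 by ring.
replace (T + be * h - T) with (be * h) in I2 by ring.
rewrite Rabs_mult in I1, I2.
apply Rmult_lt_reg_r with (Rabs h); trivial.
rewrite <- Rabs_mult.
replace (((f (X + al * h) (T + be * h) - f X T) / h - (al * fx X T + be * ft X T)) * h)
  with ((f (X + al * h) (T + be * h) - f X (T + be * h) - fx X T * (al * h))
     + (f X (T + be * h) - f X T - ft X T * (be * h))) by (field; trivial).
eapply Rle_lt_trans; [apply Rabs_triang|].
apply Rle_lt_trans with (eps / (2 * K) * (K * Rabs h)).
- apply Rle_trans with (eps / (2 * K) * ((Rabs al + Rabs be) * Rabs h)); [lra|].
  apply Rmult_le_compat_l; [lra|]; apply Rmult_le_compat_r; unfold K; lra.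
- replace (eps / (2 * K) * (K * Rabs h)) with (eps / 2 * Rabs h) by (field; lra).
  apply Rmult_lt_compat_r; lra.
Qed.

Lemma mono_pos (k k' : R -> R) (h : R) :
  (forall y, derivable_pt_lim k y (k' y)) -> (forall y, 0 <= y -> 0 <= k' y) ->
  0 <= h -> k 0 <= k h.
Proof.
intros D P [hh | <-]; [|lra].
destruct (MVT_cor2 k k' 0 h hh (fun c _ => D c)) as (c & E & hc).
assert (0 <= k' c * (h - 0)) by (apply Rmult_le_pos; [apply P|]; lra); lra.
Qed.

(** The bound g3 >= -K is integrated three times; each integration is the monotonicity of a function
    corrected by a polynomial of degree at most 3. *)
Lemma taylor2_lower (g g1 g2 g3 : R -> R) (K h : R) :
  (forall y, derivable_pt_lim g y (g1 y)) -> (forall y, derivable_pt_lim g1 y (g2 y)) ->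
  (forall y, derivable_pt_lim g2 y (g3 y)) -> (forall y, Rabs (g3 y) <= K) ->
  0 <= h -> g 0 + h * g1 0 + h ^ 2 / 2 * g2 0 - K * h ^ 3 / 6 <= g h.
Proof.
intros D1 D2 D3 B.
assert (forall a b c (y : R), derivable_pt_lim (fun x => a * x ^ 3 + b * x ^ 2 + c * x) y
   (a * (3 * y ^ 2) + b * (2 * y) + c)) as DP.
{ intros a b c y.
  replace (a * (3 * y ^ 2) + b * (2 * y) + c) with
    (a * (INR 3 * y ^ 2) + b * (INR 2 * y ^ 1) + c * 1) by (cbn; ring).
  apply (derivable_pt_lim_plus (fun x => a * x ^ 3 + b * x ^ 2) (fun x => c * x)).
  - apply (derivable_pt_lim_plus (fun x => a * x ^ 3) (fun x => b * x ^ 2)).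
    + exact (derivable_pt_lim_scal (fun x => x ^ 3) a y _ (derivable_pt_lim_pow y 3)).
    + exact (derivable_pt_lim_scal (fun x => x ^ 2) b y _ (derivable_pt_lim_pow y 2)).
  - exact (derivable_pt_lim_scal id c y _ (derivable_pt_lim_id y)). }
assert (forall y, 0 <= y -> g2 0 <= g2 y + K * y) as L2.
{ intros y hy.
  pose proof (mono_pos (fun x => g2 x + (0 * x ^ 3 + 0 * x ^ 2 + K * x))
    (fun x => g3 x + (0 * (3 * x ^ 2) + 0 * (2 * x) + K)) y) as m; cbn beta in m.
  apply Rle_trans with (g2 0 + (0 * 0 ^ 3 + 0 * 0 ^ 2 + K * 0)); [lra|].
  eapply Rle_trans; [apply m|lra]; trivial.
  - intros x; apply (derivable_pt_lim_plus g2); auto.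
  - intros x _; pose proof (B x) as b; apply Rabs_le_inv in b; lra. }
assert (forall y, 0 <= y -> g1 0 <= g1 y + K / 2 * y ^ 2 - g2 0 * y) as L1.
{ intros y hy.
  pose proof (mono_pos (fun x => g1 x + (0 * x ^ 3 + K / 2 * x ^ 2 + - g2 0 * x))
    (fun x => g2 x + (0 * (3 * x ^ 2) + K / 2 * (2 * x) + - g2 0)) y) as m; cbn beta in m.
  apply Rle_trans with (g1 0 + (0 * 0 ^ 3 + K / 2 * 0 ^ 2 + - g2 0 * 0)); [lra|].
  eapply Rle_trans; [apply m|lra]; trivial.
  - intros x; apply (derivable_pt_lim_plus g1); auto.
  - intros x hx; pose proof (L2 x hx); lra. }
intros hh.
pose proof (mono_pos (fun x => g x + (K / 6 * x ^ 3 + - g2 0 / 2 * x ^ 2 + - g1 0 * x))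
    (fun x => g1 x + (K / 6 * (3 * x ^ 2) + - g2 0 / 2 * (2 * x) + - g1 0)) h) as m; cbn beta in m.
assert (g 0 <= g h + (K / 6 * h ^ 3 + - g2 0 / 2 * h ^ 2 + - g1 0 * h)); [|lra].
apply Rle_trans with (g 0 + (K / 6 * 0 ^ 3 + - g2 0 / 2 * 0 ^ 2 + - g1 0 * 0)); [lra|].
apply m; trivial.
- intros x; apply (derivable_pt_lim_plus g); auto.
- intros x hx; pose proof (L1 x hx); lra.
Qed.

(** Divide by h, respectively h^2, and let h tend to 0. This turns Taylor inequalities into the
    first and second order conditions at a maximum. *)
Lemma nonpos_of_small (a b K : R) :
  (forall h, 0 < h -> a * h + b * h ^ 2 <= K * h ^ 3) -> a <= 0 /\ (a = 0 -> b <= 0).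
Proof.
intros H.
assert (forall a b, (forall h, 0 < h -> h < 1 -> a <= b * h) -> a <= 0) as lim.
{ intros u v Huv; destruct (Rle_or_lt u 0) as [|up]; trivial; exfalso.
  assert (0 <= Rabs v) as vp by apply Rabs_pos.
  (* With this h < 1 one has |v| h <= u / 2, which contradicts u <= v h. *)
  pose (h := u / (2 * (Rabs v + u + 1))).
  assert (h * (2 * (Rabs v + u + 1)) = u) as E by (unfold h; field; lra).
  assert (0 < h) as hp by (apply Rdiv_lt_0_compat; lra).
  assert (h < 1) as h1.
  { destruct (Rlt_or_le h 1) as [|h1]; trivial; exfalso.
    apply (Rmult_le_compat_r (2 * (Rabs v + u + 1))) in h1; lra. }
  pose proof (Huv h hp h1) as I.
  pose proof (Rmult_le_compat_r h _ _ (Rlt_le _ _ hp) (Rle_abs v)).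
  pose proof (Rmult_lt_0_compat _ _ hp up); lra. }
assert (a <= 0) as ha.
{ apply (lim a (Rabs b + Rabs K)); intros h hp h1.
  pose proof (H h hp) as Hh.
  assert (a + b * h <= K * h ^ 2) as I.
  { apply Rmult_le_reg_l with h; trivial; lra. }
  assert (0 <= Rabs K) as Kp by apply Rabs_pos.
  assert (h ^ 2 <= h) as h2 by nra.
  pose proof (Rmult_le_compat_r (h ^ 2) _ _ (pow2_ge_0 h) (Rle_abs K)).
  pose proof (Rmult_le_compat_l _ _ _ Kp h2).
  pose proof (Rmult_le_compat_r h _ _ (Rlt_le _ _ hp) (Rle_abs (- b))) as I'.
  rewrite Rabs_Ropp in I'; lra. }
split; trivial; intros ->.
apply (lim b K); intros h hp _; pose proof (H h hp) as Hh.
apply Rmult_le_reg_l with (h ^ 2); [apply pow_lt; trivial | lra].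
Qed.

Lemma cv_subsequence (u : nat -> R) (phi : nat -> nat) (l : R) :
  (forall n, (n <= phi n)%nat) -> Un_cv u l -> Un_cv (fun n => u (phi n)) l.
Proof.
intros hphi H eps he; destruct (H eps he) as [N HN]; exists N; intros n hn.
apply HN; specialize (hphi n); lia.
Qed.

Lemma cv_const (c : R) : Un_cv (fun _ => c) c.
Proof. intros eps he; exists 0%nat; intros; rewrite Rdist_eq; trivial. Qed.

Lemma cv_of_inv_bound (u : nat -> R) (l : R) :
  (forall n, Rabs (u n - l) < / (INR n + 1)) -> Un_cv u l.
Proof.
intros H eps he; destruct (archimed_cor1 eps he) as (N & HN & Np).
exists N; intros n hn; unfold Rdist; eapply Rlt_trans; [apply H|].
eapply Rle_lt_trans; [|exact HN].
apply Rinv_le_contravar; [apply lt_0_INR; trivial|].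
apply le_INR in hn; lra.
Qed.

(** Bolzano-Weierstrass one coordinate at a time. The condition n <= phi n replaces strict
    monotonicity: it is stable under composition and preserves limits. *)
Lemma bounded_subsequence (Z : nat -> nat -> R) (B : R) (k : nat) :
  (forall n i, Rabs (Z n i) <= B) ->
  exists phi z, (forall n, (n <= phi n)%nat) /\
    forall i, (i < k)%nat -> Un_cv (fun n => Z (phi n) i) (z i).
Proof.
intros HB; induction k as [|k (phi & z & hphi & hz)].
- exists (fun n => n), (fun _ => 0); split; intros; lia.
- destruct (Bolzano_Weierstrass (fun n => Z (phi n) k) (fun c => - B <= c <= B)) as [l Hl].
  + apply compact_P3.
  + intros n; apply Rabs_le_inv, HB.
  + assert (forall n, exists m, (n <= m)%nat /\ Rabs (Z (phi m) k - l) < / (INR n + 1)) as pick.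
    { intros n; pose proof (pos_INR n).
      assert (0 < / (INR n + 1)) as hp by (apply Rinv_0_lt_compat; lra).
      destruct (Hl (disc l (mkposreal _ hp)) n) as (m & hm & hd).
      - exists (mkposreal _ hp); intros y hy; exact hy.
      - exists m; auto. }
    apply functional_choice in pick as [psi hpsi].
    exists (fun n => phi (psi n)), (fun i => if Nat.eqb i k then l else z i); split.
    * intros n; destruct (hpsi n); specialize (hphi (psi n)); lia.
    * intros i hi; destruct (Nat.eqb_spec i k) as [-> | ne].
      -- apply cv_of_inv_bound; intros n; apply hpsi.
      -- apply (cv_subsequence (fun n => Z (phi n) i)); [apply hpsi | apply hz; lia].
Qed.

(** * Polynomial functions of the state and the two flows *)

(** Variables 0 to 5 stand for the real and imaginary parts of p, p_x and p_xx. *)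
Inductive pexpr :=
  | PV (i : nat) | PC (c : R) | PA (e f : pexpr) | PM (e f : pexpr).

Declare Scope pexpr_scope.
Delimit Scope pexpr_scope with P.
Bind Scope pexpr_scope with pexpr.
Infix "+" := PA : pexpr_scope.
Infix "*" := PM : pexpr_scope.
Notation "e - f" := (PA e (PM (PC (-1)) f)) : pexpr_scope.

Fixpoint ev (e : pexpr) (z : nat -> R) : R :=
  match e with
  | PV i => z i
  | PC c => c
  | PA e f => ev e z + ev f z
  | PM e f => ev e z * ev f z
  end.

(** The Lie derivative along the polynomial vector field [W]. It stays within [pexpr], so it can be
    iterated and evaluated at limits of states. *)
Fixpoint pder (W : nat -> pexpr) (e : pexpr) : pexpr :=
  match e with
  | PV i => W i
  | PC _ => PC 0
  | PA e f => pder W e + pder W f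
  | PM e f => pder W e * f + e * pder W f
  end%P.

Lemma ev_derive (W : nat -> pexpr) (g : R -> nat -> R) (h : R) (e : pexpr) :
  (forall i, derivable_pt_lim (fun y => g y i) h (ev (W i) (g h))) ->
  derivable_pt_lim (fun y => ev e (g y)) h (ev (pder W e) (g h)).
Proof.
intros H; induction e as [i | c | e IHe f IHf | e IHe f IHf]; cbn.
- apply H.
- apply derivable_pt_lim_const.
- exact (derivable_pt_lim_plus _ _ _ _ _ IHe IHf).
- exact (derivable_pt_lim_mult _ _ _ _ _ IHe IHf).
Qed.

Lemma ev_bounded (B : R) (e : pexpr) :
  exists K, forall z, (forall i, Rabs (z i) <= B) -> Rabs (ev e z) <= K.
Proof.
induction e as [i | c | e [K HK] f [L HL] | e [K HK] f [L HL]].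
- exists B; intros z hz; apply hz.
- exists (Rabs c); intros; apply Rle_refl.
- exists (K + L); intros z hz; cbn.
  eapply Rle_trans; [apply Rabs_triang | apply Rplus_le_compat; auto].
- exists (K * L); intros z hz; cbn; rewrite Rabs_mult.
  apply Rmult_le_compat; auto using Rabs_pos.
Qed.

Lemma ev_cv (Z : nat -> nat -> R) (z : nat -> R) (e : pexpr) :
  (forall i, Un_cv (fun n => Z n i) (z i)) -> Un_cv (fun n => ev e (Z n)) (ev e z).
Proof.
intros H; induction e as [i | c | e IHe f IHf | e IHe f IHf]; cbn.
- apply H.
- intros eps he; exists 0%nat; intros; rewrite Rdist_eq; trivial.
- exact (CV_plus _ _ _ _ IHe IHf).
- exact (CV_mult _ _ _ _ IHe IHf).
Qed.

(** The formula for p_xxx is the coefficient of lambda^0 in the (1,2) entry of Psi_x = [U, Psi]. *)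
Definition flow_x (c0 c1 c2 : R) (i : nat) : pexpr :=
  let n := (PV 0 * PV 0 + PV 1 * PV 1)%P in
  match i with
  | 0 => PV 2 | 1 => PV 3 | 2 => PV 4 | 3 => PV 5
  | 4 => PC (-6) * n * PV 2 + PC (4 * c1) * PV 2 - PC (2 * c2) * PV 5
         - PC (4 * c2) * n * PV 1 + PC (8 * c0) * PV 1
  | 5 => PC (-6) * n * PV 3 + PC (4 * c1) * PV 3 + PC (2 * c2) * PV 4
         + PC (4 * c2) * n * PV 0 - PC (8 * c0) * PV 0
  | _ => PC 0
  end%P%nat.

(** The formula for p_t is the NLS equation; those for p_xt and p_xxt are its x-derivatives. *)
Definition flow_t (c0 c1 c2 : R) (i : nat) : pexpr :=
  let n := (PV 0 * PV 0 + PV 1 * PV 1)%P in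
  let u := (PC 0 - PV 5 - PC 2 * n * PV 1)%P in
  let v := (PV 4 + PC 2 * n * PV 0)%P in
  match i with
  | 0 => u | 1 => v
  | 2 => pder (flow_x c0 c1 c2) u | 3 => pder (flow_x c0 c1 c2) v
  | 4 => pder (flow_x c0 c1 c2) (pder (flow_x c0 c1 c2) u)
  | 5 => pder (flow_x c0 c1 c2) (pder (flow_x c0 c1 c2) v)
  | _ => PC 0
  end%nat.

Definition flow_dir (c0 c1 c2 al be : R) (i : nat) : pexpr :=
  (PC al * flow_x c0 c1 c2 i + PC be * flow_t c0 c1 c2 i)%P.

Definition norm2E : pexpr := (PV 0 * PV 0 + PV 1 * PV 1)%P.

Lemma grad_x (c0 c1 c2 : R) (z : nat -> R) :
  ev (pder (flow_dir c0 c1 c2 1 0) norm2E) z = 2 * (z 0%nat * z 2%nat + z 1%nat * z 3%nat).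
Proof. cbn; ring. Qed.

(** The cubic term of the NLS equation only rotates the phase of p, so it drops out. *)
Lemma grad_t (c0 c1 c2 : R) (z : nat -> R) :
  ev (pder (flow_dir c0 c1 c2 0 1) norm2E) z = 2 * (z 1%nat * z 4%nat - z 0%nat * z 5%nat).
Proof. cbn; ring. Qed.

(** The hypotheses say p_x = i be' p and p_xx = de p with |p| = a; rotating p to a gives the
    arguments of [hxx], [hxt] and [htt]. *)
Lemma hessian (c0 c1 c2 al be a be' de : R) (z : nat -> R) :
  a ^ 2 = z 0%nat ^ 2 + z 1%nat ^ 2 ->
  z 2%nat = - be' * z 1%nat -> z 3%nat = be' * z 0%nat ->
  z 4%nat = de * z 0%nat -> z 5%nat = de * z 1%nat ->
  ev (pder (flow_dir c0 c1 c2 al be) (pder (flow_dir c0 c1 c2 al be) norm2E)) z =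
  al ^ 2 * hxx a (a * be') (a * de) + 2 * (al * be) * hxt a (a * be') (a * de) c0 c1 c2
  + be ^ 2 * htt a (a * be') (a * de) c0 c1 c2.
Proof.
intros Ha E2 E3 E4 E5; cbn; rewrite E2, E3, E4, E5; unfold hxx, hxt, htt.
clear -Ha; generalize dependent (z 0%nat); generalize (z 1%nat); intros y x Ha.
ring [Ha].
Qed.

(** * Orbits of the two flows and extremal limit states *)

(** The partial derivatives are named as functions in order to record their joint continuity, which
    [line_derivative] requires. *)
Definition is_orbit (c0 c1 c2 : R) (S : R -> R -> nat -> R) : Prop :=
  forall i, exists fx ft, cont2 fx /\ cont2 ft /\
    (forall x t, derivable_pt_lim (fun y => S y t i) x (fx x t)) /\
    (forall x t, derivable_pt_lim (fun y => S x y i) t (ft x t)) /\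
    (forall x t, fx x t = ev (flow_x c0 c1 c2 i) (S x t)) /\
    (forall x t, ft x t = ev (flow_t c0 c1 c2 i) (S x t)).

(** Extrema of |p| need not be attained on the plane, but they are attained on the closure of the
    set of states. *)
Definition limit_state (S : R -> R -> nat -> R) (z : nat -> R) : Prop :=
  exists xs ts : nat -> R, forall i, Un_cv (fun n => S (xs n) (ts n) i) (z i).

Lemma limit_le (S : R -> R -> nat -> R) (z : nat -> R) (e : pexpr) (c : R) :
  limit_state S z -> (forall x t, ev e (S x t) <= c) -> ev e z <= c.
Proof.
intros (xs & ts & H) le.
eapply Rle_cv_lim; [| apply ev_cv, H | apply cv_const]; intros n; apply le.
Qed.

Lemma limit_eq (S : R -> R -> nat -> R) (z : nat -> R) (e : pexpr) (c : R) :
  limit_state S z -> (forall x t, ev e (S x t) = c) -> ev e z = c.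
Proof.
intros L H; apply Rle_antisym.
- apply (limit_le S); trivial; intros; rewrite H; lra.
- assert (ev (PC (-1) * e) z <= - c) as I; [|cbn in I; lra].
  apply (limit_le S); trivial; intros; cbn; rewrite H; lra.
Qed.

Lemma sup_limit_state (S : R -> R -> nat -> R) (B : R) (e : pexpr) :
  (forall x t i, Rabs (S x t i) <= B) -> (forall x t i, (6 <= i)%nat -> S x t i = 0) ->
  exists z, limit_state S z /\ forall x t, ev e (S x t) <= ev e z.
Proof.
intros HB H6.
destruct (ev_bounded B e) as [K HK].
destruct (completeness (fun y => exists x t, y = ev e (S x t))) as [M [HM1 HM2]].
- exists K; intros y (x & t & ->); apply Rle_trans with (1 := Rle_abs _); auto.
- exists (ev e (S 0 0)); eauto.
(* A maximizing sequence, within 1/(n+1) of the supremum. *)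
- assert (forall n, exists xt : R * R,
    Rabs (ev e (S (fst xt) (snd xt)) - M) < / (INR n + 1)) as pick.
  { intros n; pose proof (pos_INR n).
    assert (0 < / (INR n + 1)) as hp by (apply Rinv_0_lt_compat; lra).
    apply NNPP; intros no.
    assert (M <= M - / (INR n + 1)); [|lra].
    apply HM2; intros y (x & t & ->).
    assert (ev e (S x t) <= M) by (apply HM1; eauto).
    apply Rnot_lt_le; intros lt; apply no; exists (x, t); cbn.
    apply Rabs_def1; lra. }
  apply functional_choice in pick as [xt Hxt].
  destruct (bounded_subsequence (fun n => S (fst (xt n)) (snd (xt n))) B 6)
    as (phi & z & hphi & hz); [intros; apply HB|].
  assert (forall i, Un_cv (fun n => S (fst (xt (phi n))) (snd (xt (phi n))) i)
    (if (i <? 6)%nat then z i else 0)) as cv.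
  { intros i; destruct (Nat.ltb_spec i 6); [apply hz; trivial|].
    intros eps he; exists 0%nat; intros; rewrite H6, Rdist_eq; trivial. }
  exists (fun i => if (i <? 6)%nat then z i else 0); split.
  + do 2 eexists; exact cv.
  + intros x t; apply (ev_cv _ _ e) in cv.
    apply (UL_sequence _ _ M) in cv.
    * rewrite cv; apply HM1; eauto.
    * apply (cv_subsequence (fun n => ev e (S (fst (xt n)) (snd (xt n))))); trivial.
      apply cv_of_inv_bound, Hxt.
Qed.

Lemma orbit_line (c0 c1 c2 : R) (S : R -> R -> nat -> R) (x t al be h : R) (e : pexpr) :
  is_orbit c0 c1 c2 S ->
  derivable_pt_lim (fun y => ev e (S (x + al * y) (t + be * y))) h
    (ev (pder (flow_dir c0 c1 c2 al be) e) (S (x + al * h) (t + be * h))).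
Proof.
intros H; apply (ev_derive (flow_dir c0 c1 c2 al be) (fun y => S (x + al * y) (t + be * y))).
intros i; destruct (H i) as (fx & ft & cx & ct & Dx & Dt & Ex & Et).
cbn; rewrite <- Ex, <- Et.
apply (line_derivative (fun x t => S x t i)); trivial.
Qed.

(** No orbit through [z] is constructed: Taylor's inequality is applied at the approximating points,
    with a uniform bound on third derivatives, and each inequality between polynomials in the state
    passes to the limit for fixed h. *)
Lemma extremal_derivatives (c0 c1 c2 : R) (S : R -> R -> nat -> R) (B : R) (e : pexpr)
    (z : nat -> R) (al be : R) :
  is_orbit c0 c1 c2 S -> (forall x t i, Rabs (S x t i) <= B) ->
  limit_state S z -> (forall x t, ev e (S x t) <= ev e z) ->
  ev (pder (flow_dir c0 c1 c2 al be) e) z = 0 /\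
  ev (pder (flow_dir c0 c1 c2 al be) (pder (flow_dir c0 c1 c2 al be) e)) z <= 0.
Proof.
intros O HB (xs & ts & cv) M.
assert (forall al be, let W := flow_dir c0 c1 c2 al be in
   ev (pder W e) z <= 0 /\ (ev (pder W e) z = 0 -> ev (pder W (pder W e)) z <= 0)) as half.
{ intros a b W.
  destruct (ev_bounded B (pder W (pder W (pder W e)))) as [K HK].
  destruct (nonpos_of_small (ev (pder W e) z) (ev (pder W (pder W e)) z / 2) (K / 6))
    as [I1 I2]; [|split; [trivial | intros E; specialize (I2 E); lra]].
  intros h hp.
  assert (ev (e + PC h * pder W e + PC (h ^ 2 / 2) * pder W (pder W e)) z
     <= ev e z + K * h ^ 3 / 6) as I; [|cbn [ev] in I; lra].
  eapply Rle_cv_lim; [| apply ev_cv, cv | apply cv_const].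
  intros n; cbn [ev]; change (fun i => S (xs n) (ts n) i) with (S (xs n) (ts n)).
  pose proof (taylor2_lower (fun y => ev e (S (xs n + a * y) (ts n + b * y)))
   (fun y => ev (pder W e) (S (xs n + a * y) (ts n + b * y)))
   (fun y => ev (pder W (pder W e)) (S (xs n + a * y) (ts n + b * y)))
   (fun y => ev (pder W (pder W (pder W e))) (S (xs n + a * y) (ts n + b * y))) K h) as T.
  cbn beta in T; replace (xs n + a * 0) with (xs n) in T by ring.
  replace (ts n + b * 0) with (ts n) in T by ring.
  specialize (M (xs n + a * h) (ts n + b * h)).
  lapply T; [clear T; intros T | intros y; apply orbit_line; trivial].
  lapply T; [clear T; intros T | intros y; apply orbit_line; trivial].
  lapply T; [clear T; intros T | intros y; apply orbit_line; trivial].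
  lapply T; [clear T; intros T | intros y; apply HK; intros i; apply HB].
  lapply T; [clear T; intros T; cbn beta in M; lra | lra]. }
(* Reversing the direction changes the sign of the first derivative, which must therefore vanish. *)
destruct (half al be) as [I1 I2], (half (- al) (- be)) as [J1 _].
assert (forall f, ev (pder (flow_dir c0 c1 c2 (- al) (- be)) f) z
   = - ev (pder (flow_dir c0 c1 c2 al be) f) z) as neg.
{ induction f as [i | | f IHf g IHg | f IHf g IHg]; cbn; try rewrite IHf, IHg; ring. }
rewrite neg in J1; split; [|apply I2]; lra.
Qed.

(** * The spectral polynomial as a function of the state *)

Definition iPsi11E (c0 c1 c2 l : R) : pexpr :=
  (PC (l ^ 3 + c2 * l ^ 2 + c1 * l + c0) - PC (l / 2 + c2 / 2) * norm2E
   + PC (1 / 2) * (PV 3 * PV 0 - PV 2 * PV 1))%P.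
Definition Psi12reE (c1 c2 l : R) : pexpr :=
  (PC (- l ^ 2 - c2 * l - c1) * PV 1 - PC (l / 2 + c2 / 2) * PV 2
   + PC (1 / 4) * PV 5 + PC (1 / 2) * PV 1 * norm2E)%P.
Definition Psi12imE (c1 c2 l : R) : pexpr :=
  (PC (l ^ 2 + c2 * l + c1) * PV 0 - PC (l / 2 + c2 / 2) * PV 3
   - PC (1 / 4) * PV 4 - PC (1 / 2) * PV 0 * norm2E)%P.
(** For real l, i Psi11 is real and Psi21 is minus the conjugate of Psi12, so R(l) is a sum of three
    real squares. *)
Definition specE (c0 c1 c2 l : R) : pexpr :=
  (iPsi11E c0 c1 c2 l * iPsi11E c0 c1 c2 l + Psi12reE c1 c2 l * Psi12reE c1 c2 l + Psi12imE c1 c2 l * Psi12imE c1 c2 l)%P.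

Definition state (D : nat -> nat -> R -> R -> Cplx) (x t : R) (i : nat) : R :=
  match i with
  | 0 => Re (D 0 0 x t) | 1 => Im (D 0 0 x t)
  | 2 => Re (D 1 0 x t) | 3 => Im (D 1 0 x t)
  | 4 => Re (D 2 0 x t) | 5 => Im (D 2 0 x t)
  | _ => 0%R
  end%nat.

Lemma state_spec (D : nat -> nat -> R -> R -> Cplx) (c0 c1 c2 r1 r2 r3 s1 s2 s3 l x t : R) :
  spec_poly D c0 c1 c2 (mkC l 0) x t =
     Cprod (map (fun mu => Csub (mkC l 0) mu)
       [mkC r1 s1; mkC r1 (- s1); mkC r2 s2; mkC r2 (- s2); mkC r3 s3; mkC r3 (- s3)]) ->
  ev (specE c0 c1 c2 l) (state D x t) = spec_real r1 r2 r3 s1 s2 s3 l.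
Proof.
intros H; apply (f_equal Re) in H.
transitivity (Re (spec_poly D c0 c1 c2 (mkC l 0) x t)).
- unfold spec_poly, Psi11, Psi12, Psi21, Cnorm2; cbn.
  generalize (Re (D 0%nat 0%nat x t)) (Im (D 0%nat 0%nat x t)) (Re (D 1%nat 0%nat x t))
   (Im (D 1%nat 0%nat x t)) (Re (D 2%nat 0%nat x t)) (Im (D 2%nat 0%nat x t)).
  clear; intros; field.
- rewrite H; unfold spec_real; cbn; ring.
Qed.

(** At such a state Psi12 is i p times a real quadratic polynomial in l, so |Psi12|^2 is the square
    of a times that polynomial. *)
Lemma ev_specE_crit (c0 c1 c2 a be' de l : R) (z : nat -> R) :
  a ^ 2 = z 0%nat ^ 2 + z 1%nat ^ 2 ->
  z 2%nat = - be' * z 1%nat -> z 3%nat = be' * z 0%nat ->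
  z 4%nat = de * z 0%nat -> z 5%nat = de * z 1%nat ->
  ev (specE c0 c1 c2 l) z =
   (l ^ 3 + c2 * l ^ 2 + (c1 - a ^ 2 / 2) * l + (c0 - c2 * a ^ 2 / 2 + a * (a * be') / 2)) ^ 2
   + (a * l ^ 2 + (c2 * a - (a * be') / 2) * l
      + (c1 * a - (a * de) / 4 - a ^ 3 / 2 - c2 * (a * be') / 2)) ^ 2.
Proof.
intros Ha E2 E3 E4 E5; cbn; rewrite E2, E3, E4, E5.
clear -Ha; generalize dependent (z 0%nat); generalize (z 1%nat); intros y x Ha.
field [Ha].
Qed.

(** |Psi12|^2 <= R(l) bounds Psi12 at l = 0, 1, -1. Its second difference there gives p, its first
    difference then gives p_x, and its value at 0 gives p_xx. *)
Lemma state_bounded (D : nat -> nat -> R -> R -> Cplx) (c0 c1 c2 r1 r2 r3 s1 s2 s3 : R) :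
  (forall l x t, ev (specE c0 c1 c2 l) (state D x t) = spec_real r1 r2 r3 s1 s2 s3 l) ->
  exists B, forall x t i, Rabs (state D x t i) <= B.
Proof.
intros H.
assert (forall l, exists K, forall x t, Rabs (ev (Psi12reE c1 c2 l) (state D x t)) <= K /\
   Rabs (ev (Psi12imE c1 c2 l) (state D x t)) <= K) as q.
{ intros l; exists (1 + spec_real r1 r2 r3 s1 s2 s3 l); intros x t; rewrite <- (H l x t).
  unfold specE; cbn [ev].
  generalize (ev (iPsi11E c0 c1 c2 l) (state D x t)) (ev (Psi12reE c1 c2 l) (state D x t))
    (ev (Psi12imE c1 c2 l) (state D x t)); intros a b c.
  split; apply Rabs_le; nra. }
destruct (q 0) as [K0 H0], (q 1) as [K1 H1], (q (-1)) as [K2 H2].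
pose (L := K0 + K1 + K2).
assert (exists K, forall x t, let z := state D x t in
  Rabs (z 0%nat) <= K /\ Rabs (z 1%nat) <= K) as [K HK].
{ exists L; intros x t z; destruct (H0 x t) as [a0 b0], (H1 x t) as [a1 b1], (H2 x t) as [a2 b2].
  fold z in a0, a1, a2, b0, b1, b2; clearbody z; unfold Psi12reE, Psi12imE in *; cbn in a0, a1, a2, b0, b1, b2.
  apply Rabs_le_inv in a0, a1, a2, b0, b1, b2.
  unfold L; split; apply Rabs_le; lra. }
assert (exists K', forall x t, let z := state D x t in
  Rabs (z 2%nat) <= K' /\ Rabs (z 3%nat) <= K') as [K' HK'].
{ exists (L + Rabs c2 * 2 * K + L); intros x t z; destruct (HK x t) as [k0 k1].
  destruct (H0 x t) as [a0 b0], (H1 x t) as [a1 b1], (H2 x t) as [a2 b2].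
  fold z in a0, a1, a2, b0, b1, b2, k0, k1; clearbody z; unfold Psi12reE, Psi12imE in *; cbn in a0, a1, a2, b0, b1, b2.
  assert (Rabs (c2 * z 0%nat) <= Rabs c2 * K /\ Rabs (c2 * z 1%nat) <= Rabs c2 * K) as [m0 m1].
  { split; rewrite Rabs_mult; apply Rmult_le_compat_l; trivial using Rabs_pos. }
  apply Rabs_le_inv in a0, a1, a2, b0, b1, b2, m0, m1, k0, k1.
  unfold L; split; apply Rabs_le; lra. }
assert (exists K'', forall x t, let z := state D x t in
  Rabs (z 4%nat) <= K'' /\ Rabs (z 5%nat) <= K'') as [K'' HK''].
(* [G0] and [G1] are what remains of p_xx after removing its multiple of Psi12 at 0; they involve
   only p and p_x. *)
{ pose (G0 := (PC (4 * c1) * PV 0 - PC (2 * c2) * PV 3 - PC 2 * PV 0 * norm2E)%P).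
  pose (G1 := (PC (4 * c1) * PV 1 + PC (2 * c2) * PV 2 - PC 2 * PV 1 * norm2E)%P).
  destruct (ev_bounded (K + K') G0) as [J0 HJ0], (ev_bounded (K + K') G1) as [J1 HJ1].
  exists (4 * L + J0 + J1); intros x t z; destruct (HK x t) as [k0 k1], (HK' x t) as [k2 k3].
  destruct (H0 x t) as [a0 b0], (H1 x t) as [a1 b1], (H2 x t) as [a2 b2].
  fold z in a0, a1, a2, b0, b1, b2, k0, k1, k2, k3; clearbody z.
  (* The state is truncated before p_xx, whose bound is still to be found. *)
  pose (z' := fun i => if (i <? 4)%nat then z i else 0).
  assert (forall i, Rabs (z' i) <= K + K') as hz'.
  { pose proof (Rabs_pos (z 0%nat)); pose proof (Rabs_pos (z 2%nat)).
    intros [|[|[|[|i]]]]; cbn in *; try lra; rewrite Rabs_R0; lra. }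
  specialize (HJ0 z' hz'); specialize (HJ1 z' hz').
  unfold Psi12reE, Psi12imE in *; cbn in a0, a1, a2, b0, b1, b2, HJ0, HJ1.
  apply Rabs_le_inv in a0, a1, a2, b0, b1, b2, HJ0, HJ1.
  unfold L; split; apply Rabs_le; lra. }
exists (K + K' + K''); intros x t i.
destruct (HK x t) as [k0 k1], (HK' x t) as [k2 k3], (HK'' x t) as [k4 k5].
pose proof (Rabs_pos (state D x t 0%nat)); pose proof (Rabs_pos (state D x t 2%nat)).
pose proof (Rabs_pos (state D x t 4%nat)).
destruct i as [|[|[|[|[|[|i]]]]]]; try lra.
cbn -[Rabs]; rewrite Rabs_R0; lra.
Qed.

(** * The two-phase solution as an orbit *)

Lemma cont2_Re (f : R -> R -> Cplx) : Ccont2 f -> cont2 (fun x t => Re (f x t)).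
Proof.
intros H x t eps he; destruct (H x t eps he) as (d & hd & Hd).
exists d; split; trivial; intros x' t' hx ht.
eapply Rle_lt_trans; [|apply (Hd x' t' hx ht)].
rewrite <- sqrt_Rsqr_abs; apply sqrt_le_1_alt; unfold Cnorm2; cbn.
pose proof (Rle_0_sqr (Im (f x' t') + - Im (f x t))); unfold Rsqr in *; lra.
Qed.

Lemma cont2_Im (f : R -> R -> Cplx) : Ccont2 f -> cont2 (fun x t => Im (f x t)).
Proof.
intros H x t eps he; destruct (H x t eps he) as (d & hd & Hd).
exists d; split; trivial; intros x' t' hx ht.
eapply Rle_lt_trans; [|apply (Hd x' t' hx ht)].
rewrite <- sqrt_Rsqr_abs; apply sqrt_le_1_alt; unfold Cnorm2; cbn.
pose proof (Rle_0_sqr (Re (f x' t') + - Re (f x t))); unfold Rsqr in *; lra.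
Qed.

Lemma derivable_pt_lim_congr (f g : R -> R) (x l l' : R) :
  (forall y, f y = g y) -> derivable_pt_lim f x l -> derivable_pt_lim g x l' -> l = l'.
Proof.
intros E Hf Hg; apply (uniqueness_limite g x); trivial.
intros eps he; destruct (Hf eps he) as [d Hd]; exists d; intros h hn hh.
rewrite <- !E; auto.
Qed.

(** Psi12 at lambda = 0 is differentiated directly and through the Lax equation; p_xxx enters the
    first result linearly, with coefficient -i/4. *)
Lemma third_derivative (p : R -> R -> Cplx) (D : nat -> nat -> R -> R -> Cplx) (c0 c1 c2 x t : R) :
  smooth_family p D -> two_phase_with D c0 c1 c2 ->
  Re (D 3%nat 0%nat x t) = ev (flow_x c0 c1 c2 4) (state D x t) /\
  Im (D 3%nat 0%nat x t) = ev (flow_x c0 c1 c2 5) (state D x t).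
Proof.
intros (_ & _ & Dx & _) tp.
destruct (tp (mkC 0 0) x t) as [(_ & [dR dI] & _) _].
(* p_xxx is not yet known to be polynomial, so its value enters as a constant. *)
pose (w := fun i : nat => match i with 4 => Re (D 3 0 x t) | 5 => Im (D 3 0 x t)
   | _ => ev (flow_x c0 c1 c2 i) (state D x t) end%nat).
assert (forall e, derivable_pt_lim (fun y => ev e (state D y t)) x
   (ev (pder (fun i => PC (w i)) e) (state D x t))) as de.
{ intros e; apply (ev_derive (fun i => PC (w i)) (fun y => state D y t)).
  destruct (Dx 0%nat 0%nat x t), (Dx 1%nat 0%nat x t), (Dx 2%nat 0%nat x t).
  intros [|[|[|[|[|[|i]]]]]]; cbn; trivial; apply derivable_pt_lim_const. }
assert (forall y, Re (m12 (Psimat D c0 c1 c2 (mkC 0 0) y t)) = ev (Psi12reE c1 c2 0) (state D y t)) as ER.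
{ intros y; cbn; unfold Cnorm2; field. }
assert (forall y, Im (m12 (Psimat D c0 c1 c2 (mkC 0 0) y t)) = ev (Psi12imE c1 c2 0) (state D y t)) as EI.
{ intros y; cbn; unfold Cnorm2; field. }
pose proof (derivable_pt_lim_congr _ _ _ _ _ ER dR (de _)) as R1.
pose proof (derivable_pt_lim_congr _ _ _ _ _ EI dI (de _)) as I1.
clear -R1 I1; cbn in R1, I1 |- *; unfold Cnorm2 in *; cbn in R1, I1.
split; lra.
Qed.

(** The family [D] gives each mixed derivative both as a t-derivative of p_x or p_xx and as an
    x-derivative, so p_xt and p_xxt follow from differentiating the NLS formula for p_t in x. *)
Lemma state_orbit (p : R -> R -> Cplx) (D : nat -> nat -> R -> R -> Cplx) (c0 c1 c2 : R) :
  smooth_family p D -> focusing_NLS D -> two_phase_with D c0 c1 c2 ->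
  is_orbit c0 c1 c2 (state D).
Proof.
intros sm nls tp.
pose proof (third_derivative p D c0 c1 c2) as D3.
assert (forall x t, Re (D 3%nat 0%nat x t) = ev (flow_x c0 c1 c2 4) (state D x t) /\
  Im (D 3%nat 0%nat x t) = ev (flow_x c0 c1 c2 5) (state D x t)) as H3 by auto; clear D3.
destruct sm as (_ & ct & Dx & Dt).
assert (forall e x t, derivable_pt_lim (fun y => ev e (state D y t)) x
   (ev (pder (flow_x c0 c1 c2) e) (state D x t))) as de.
{ intros e x t; apply (ev_derive (flow_x c0 c1 c2) (fun y => state D y t)).
  destruct (Dx 0%nat 0%nat x t), (Dx 1%nat 0%nat x t), (Dx 2%nat 0%nat x t), (H3 x t) as [HR HI].
  intros [|[|[|[|[|[|i]]]]]]; try rewrite <- HR; try rewrite <- HI; trivial;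
  apply derivable_pt_lim_const. }
assert (forall x t, Re (D 0%nat 1%nat x t) = ev (flow_t c0 c1 c2 0) (state D x t) /\
  Im (D 0%nat 1%nat x t) = ev (flow_t c0 c1 c2 1) (state D x t)) as T0.
{ intros x t; pose proof (nls x t) as N; injection N as N1 N2.
  unfold Cnorm2 in *; cbn in *; split; lra. }
assert (forall x t, Re (D 1%nat 1%nat x t) = ev (flow_t c0 c1 c2 2) (state D x t) /\
  Im (D 1%nat 1%nat x t) = ev (flow_t c0 c1 c2 3) (state D x t)) as T1.
{ intros x t; destruct (Dx 0%nat 1%nat x t) as [dR dI]; split.
  - apply (derivable_pt_lim_congr _ _ _ _ _ (fun y => proj1 (T0 y t)) dR), de.
  - apply (derivable_pt_lim_congr _ _ _ _ _ (fun y => proj2 (T0 y t)) dI), de. }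
assert (forall x t, Re (D 2%nat 1%nat x t) = ev (flow_t c0 c1 c2 4) (state D x t) /\
  Im (D 2%nat 1%nat x t) = ev (flow_t c0 c1 c2 5) (state D x t)) as T2.
{ intros x t; destruct (Dx 1%nat 1%nat x t) as [dR dI]; split.
  - apply (derivable_pt_lim_congr _ _ _ _ _ (fun y => proj1 (T1 y t)) dR), de.
  - apply (derivable_pt_lim_congr _ _ _ _ _ (fun y => proj2 (T1 y t)) dI), de. }
assert (forall k, (forall x t, derivable_pt_lim (fun y => Re (D k 0%nat y t)) x (Re (D (S k) 0%nat x t)))
  /\ (forall x t, derivable_pt_lim (fun y => Im (D k 0%nat y t)) x (Im (D (S k) 0%nat x t)))
  /\ (forall x t, derivable_pt_lim (fun y => Re (D k 0%nat x y)) t (Re (D k 1%nat x t)))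
  /\ (forall x t, derivable_pt_lim (fun y => Im (D k 0%nat x y)) t (Im (D k 1%nat x t)))) as der.
{ intros k; repeat split; intros x t; apply Dx || apply Dt. }
destruct (der 0%nat) as (a0 & b0 & e0 & f0), (der 1%nat) as (a1 & b1 & e1 & f1),
  (der 2%nat) as (a2 & b2 & e2 & f2).
intros [|[|[|[|[|[|i]]]]]].
- exists (fun x t => Re (D 1%nat 0%nat x t)), (fun x t => Re (D 0%nat 1%nat x t)).
  repeat split; trivial; try apply cont2_Re, ct; apply T0.
- exists (fun x t => Im (D 1%nat 0%nat x t)), (fun x t => Im (D 0%nat 1%nat x t)).
  repeat split; trivial; try apply cont2_Im, ct; apply T0.
- exists (fun x t => Re (D 2%nat 0%nat x t)), (fun x t => Re (D 1%nat 1%nat x t)).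
  repeat split; trivial; try apply cont2_Re, ct; apply T1.
- exists (fun x t => Im (D 2%nat 0%nat x t)), (fun x t => Im (D 1%nat 1%nat x t)).
  repeat split; trivial; try apply cont2_Im, ct; apply T1.
- exists (fun x t => Re (D 3%nat 0%nat x t)), (fun x t => Re (D 2%nat 1%nat x t)).
  repeat split; trivial; try apply cont2_Re, ct; (apply T2 || apply H3).
- exists (fun x t => Im (D 3%nat 0%nat x t)), (fun x t => Im (D 2%nat 1%nat x t)).
  repeat split; trivial; try apply cont2_Im, ct; (apply T2 || apply H3).
- exists (fun _ _ => 0), (fun _ _ => 0); repeat split; trivial;
    try (intros x t; apply derivable_pt_lim_const);
    intros x t eps he; exists 1; split; try lra; intros; rewrite Rminus_diag, Rabs_R0; trivial.
Qed.

(** * Values at extremal states and the conclusion *)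

Lemma semidefinite_det (A B C : R) :
  (forall al be, al ^ 2 * A + 2 * (al * be) * B + be ^ 2 * C <= 0) -> 0 <= A * C - B ^ 2.
Proof.
intros H; pose proof (H 1 0) as HA; pose proof (H 0 1) as HC.
destruct (Req_dec A 0) as [-> | nA].
- destruct (Req_dec B 0) as [-> | nB]; [lra | exfalso].
  (* With A = 0 the form takes the value 1 here. *)
  pose proof (H ((1 - C) / (2 * B)) 1) as I.
  replace (2 * ((1 - C) / (2 * B) * 1) * B) with (1 - C) in I by (field; trivial); lra.
(* The form at (-B, A) equals A (A C - B^2). *)
- pose proof (H (- B) A) as I.
  destruct (Rle_or_lt 0 (A * C - B ^ 2)) as [|L]; trivial; exfalso.
  assert (A < 0) as An by lra.
  pose proof (Rmult_lt_0_compat (- A) (- (A * C - B ^ 2))); lra.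
Qed.

(** Phase invariance lets a critical state with p <> 0 be written p_x = i be p, p_xx = de p
    with be and de real. *)
Lemma extremal_value (c0 c1 c2 r1 r2 r3 s1 s2 s3 eps : R) (z : nat -> R) :
  0 < s1 -> s1 <= s2 -> s2 <= s3 ->
  NoDup [mkC r1 s1; mkC r1 (- s1); mkC r2 s2; mkC r2 (- s2); mkC r3 s3; mkC r3 (- s3)] ->
  (forall l, ev (specE c0 c1 c2 l) z = spec_real r1 r2 r3 s1 s2 s3 l) ->
  0 < ev norm2E z -> eps ^ 2 = 1 ->
  (forall al be, ev (pder (flow_dir c0 c1 c2 al be) norm2E) z = 0 /\
     eps * ev (pder (flow_dir c0 c1 c2 al be) (pder (flow_dir c0 c1 c2 al be) norm2E)) z <= 0) ->
  (sqrt (ev norm2E z) = s1 + s2 + s3 \/ sqrt (ev norm2E z) = s3 - s1 - s2) /\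
  exists al be, ev (pder (flow_dir c0 c1 c2 al be) (pder (flow_dir c0 c1 c2 al be) norm2E)) z <> 0.
Proof.
intros h1 h12 h23 nd sp Np e2 crit.
pose proof (proj1 (crit 1 0)) as gx; rewrite grad_x in gx.
pose proof (proj1 (crit 0 1)) as gt; rewrite grad_t in gt.
set (a := sqrt (ev norm2E z)).
assert (0 < a) as ap by (apply sqrt_lt_R0; trivial).
assert (a ^ 2 = ev norm2E z) as a2 by (apply pow2_sqrt; lra).
cbn [ev norm2E] in a2, Np.
assert (a ^ 2 = z 0%nat ^ 2 + z 1%nat ^ 2) as Ha by lra.
(* [be] and [de] are Im(p^* p_x) / |p|^2 and Re(p^* p_xx) / |p|^2; the complementary parts vanish by
   the critical equations. *)
pose (be := (z 0%nat * z 3%nat - z 1%nat * z 2%nat) / a ^ 2).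
pose (de := (z 0%nat * z 4%nat + z 1%nat * z 5%nat) / a ^ 2).
assert (z 0%nat * z 2%nat + z 1%nat * z 3%nat = 0) as gx' by lra.
assert (z 1%nat * z 4%nat - z 0%nat * z 5%nat = 0) as gt' by lra.
assert (z 2%nat = - be * z 1%nat) as E2.
{ apply Rmult_eq_reg_r with (a ^ 2); [|lra].
  transitivity (- (z 0%nat * z 3%nat - z 1%nat * z 2%nat) * z 1%nat + z 0%nat * 0); [rewrite Ha; rewrite <- gx'; ring | unfold be; field; lra]. }
assert (z 3%nat = be * z 0%nat) as E3.
{ apply Rmult_eq_reg_r with (a ^ 2); [|lra].
  transitivity ((z 0%nat * z 3%nat - z 1%nat * z 2%nat) * z 0%nat + z 1%nat * 0); [rewrite Ha; rewrite <- gx'; ring | unfold be; field; lra]. }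
assert (z 4%nat = de * z 0%nat) as E4.
{ apply Rmult_eq_reg_r with (a ^ 2); [|lra].
  transitivity ((z 0%nat * z 4%nat + z 1%nat * z 5%nat) * z 0%nat + z 1%nat * 0); [rewrite Ha; rewrite <- gt'; ring | unfold de; field; lra]. }
assert (z 5%nat = de * z 1%nat) as E5.
{ apply Rmult_eq_reg_r with (a ^ 2); [|lra].
  transitivity ((z 0%nat * z 4%nat + z 1%nat * z 5%nat) * z 1%nat - z 0%nat * 0); [rewrite Ha; rewrite <- gt'; ring | unfold de; field; lra]. }
pose proof (fun al bt => hessian c0 c1 c2 al bt a be de z Ha E2 E3 E4 E5) as He.
set (hA := hxx a (a * be) (a * de)) in *.
set (hB := hxt a (a * be) (a * de) c0 c1 c2) in *.
set (hC := htt a (a * be) (a * de) c0 c1 c2) in *.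
assert (0 <= hA * hC - hB ^ 2) as pos.
(* The sign [eps] is 1 at a maximum and -1 at a minimum; the determinant does not see it. *)
{ replace (hA * hC - hB ^ 2) with ((eps * hA) * (eps * hC) - (eps * hB) ^ 2) by (ring [e2]).
  apply semidefinite_det; intros al bt; destruct (crit al bt) as [_ c]; rewrite He in c; lra. }
destruct (critical_value a (a * be) (a * de) c0 c1 c2 r1 r2 r3 s1 s2 s3) as [val ne]; trivial.
{ intros l; rewrite <- sp; symmetry; apply ev_specE_crit; trivial. }
split; trivial; fold hA hB hC in ne; apply NNPP; intros no.
assert (forall al bt, al ^ 2 * hA + 2 * (al * bt) * hB + bt ^ 2 * hC = 0) as Z.
{ intros al bt; rewrite <- He; apply NNPP; intros n; apply no; eauto. }
pose proof (Z 1 0) as ZA; pose proof (Z 0 1) as ZC; pose proof (Z 1 1) as ZB.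
apply ne; assert (hA = 0) as -> by lra; assert (hB = 0) as -> by lra; ring.
Qed.

Lemma vanishing_state (c0 c1 c2 r1 r2 r3 s1 s2 s3 : R) (z : nat -> R) :
  0 < s1 -> 0 < s2 -> 0 < s3 ->
  (forall l, ev (specE c0 c1 c2 l) z = spec_real r1 r2 r3 s1 s2 s3 l) ->
  ev norm2E z = 0 -> s3 <= s1 + s2.
Proof.
intros h1 h2 h3 sp N0; cbn in N0.
assert (z 0%nat = 0 /\ z 1%nat = 0) as [E0 E1] by (split; nra).
apply (node_impossible c0 c1 c2 (- z 2%nat / 2) (z 5%nat / 4 - c2 / 2 * z 2%nat)
  (- z 3%nat / 2) (- z 4%nat / 4 - c2 / 2 * z 3%nat) r1 r2 r3); trivial.
intros l; rewrite <- sp; cbn; rewrite E0, E1; field.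
Qed.

Theorem theorem7
  (p : R -> R -> Cplx) (D : nat -> nat -> R -> R -> Cplx)
  (c0 c1 c2 r1 r2 r3 s1 s2 s3 : R) :
  smooth_family p D ->
  focusing_NLS D ->
  (exists x t, p x t <> RtoC 0) ->
  two_phase_with D c0 c1 c2 ->
  (* branch points: the roots of the spectral polynomial *)
  (forall (lam : Cplx) (x t : R),
     spec_poly D c0 c1 c2 lam x t =
     Cprod (map (fun mu => Csub lam mu)
       [mkC r1 s1; mkC r1 (- s1); mkC r2 s2; mkC r2 (- s2); mkC r3 s3; mkC r3 (- s3)])) ->
  (* non-singular spectral curve: pairwise distinct branch points *)
  NoDup [mkC r1 s1; mkC r1 (- s1); mkC r2 s2; mkC r2 (- s2); mkC r3 s3; mkC r3 (- s3)] ->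
  0 < s1 -> s1 <= s2 -> s2 <= s3 ->
  is_lub (fun y => exists x t, y = Cabs (p x t)) (s1 + s2 + s3) /\
  is_glb (fun y => exists x t, y = Cabs (p x t))
         (if Rlt_dec (s1 + s2) s3 then s3 - s1 - s2 else 0).
Proof.
intros sm nls (x0 & t0 & nz) tp sp nd h1 h12 h23.
pose proof (state_orbit p D c0 c1 c2 sm nls tp) as orb.
assert (forall l x t, ev (specE c0 c1 c2 l) (state D x t) = spec_real r1 r2 r3 s1 s2 s3 l) as spS
  by (intros; apply state_spec, sp).
destruct (state_bounded D _ _ _ _ _ _ _ _ _ spS) as [B HB].
assert (forall x t i, (6 <= i)%nat -> state D x t i = 0) as H6.
{ intros x t [|[|[|[|[|[|i]]]]]] hi; try lia; reflexivity. }
assert (forall x t, Cabs (p x t) = sqrt (ev norm2E (state D x t))) as HN.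
{ intros x t; rewrite <- (proj1 sm); reflexivity. }
assert (forall z, 0 <= ev norm2E z) as Nge by (intros z; cbn; nra).
destruct (sup_limit_state (state D) B norm2E HB H6) as (z & Lz & Mz).
destruct (sup_limit_state (state D) B (PC (-1) * norm2E)%P HB H6) as (w & Lw & Mw).
pose proof (fun l => limit_eq _ _ _ _ Lz (spS l)) as spz.
pose proof (fun l => limit_eq _ _ _ _ Lw (spS l)) as spw.
assert (forall x t, ev norm2E w <= ev norm2E (state D x t)) as mw
  by (intros x t; specialize (Mw x t); cbn [ev] in Mw; lra).
pose proof (fun al be => extremal_derivatives _ _ _ _ _ _ _ al be orb HB Lz Mz) as cz.
(* Stated for any limit state [v] at the minimal level, so that it also applies to [z] if |p| were
   constant. *)
assert (forall v, limit_state (state D) v -> ev norm2E v <= ev norm2E w -> forall al be,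
    ev (pder (flow_dir c0 c1 c2 al be) norm2E) v = 0 /\
    -1 * ev (pder (flow_dir c0 c1 c2 al be) (pder (flow_dir c0 c1 c2 al be) norm2E)) v <= 0) as cw.
{ intros v Lv le al be.
  assert (forall x t, ev (PC (-1) * norm2E)%P (state D x t) <= ev (PC (-1) * norm2E)%P v) as Mv.
  { intros x t; cbn [ev]; specialize (mw x t); lra. }
  destruct (extremal_derivatives _ _ _ _ _ _ _ al be orb HB Lv Mv) as [d1 d2].
  cbn [ev pder] in d1, d2; split; lra. }
assert (0 < ev norm2E z) as Nz.
{ apply Rlt_le_trans with (ev norm2E (state D x0 t0)); [|apply Mz].
  destruct (Nge (state D x0 t0)) as [|E]; trivial; exfalso; apply nz.
  rewrite <- (proj1 sm); cbn in E; apply Cplx_eq; cbn; nra. }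
destruct (extremal_value c0 c1 c2 r1 r2 r3 s1 s2 s3 1 z) as (vz & al & be & nez);
  trivial; try lra.
{ intros a b; destruct (cz a b); split; lra. }
(* Otherwise [z] is both a maximum and a minimum, so every second derivative vanishes there, against
   [nez]. *)
assert (ev norm2E w < ev norm2E z) as lt.
{ apply Rnot_le_lt; intros le; apply nez.
  destruct (cz al be) as [_ I1], (cw z Lz le al be) as [_ I2]; lra. }
assert (0 < ev norm2E w -> sqrt (ev norm2E w) = s1 + s2 + s3 \/ sqrt (ev norm2E w) = s3 - s1 - s2) as vw.
{ intros Nw; apply (extremal_value c0 c1 c2 r1 r2 r3 s1 s2 s3 (-1) w); trivial; try lra.
  apply cw; trivial; lra. }
pose proof (sqrt_lt_1_alt _ _ (conj (Nge w) lt)) as ltS.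
(* Strict inequality of the two extrema assigns the larger candidate to [z]. A positive minimum is
   then s3 - s1 - s2, and a zero minimum forces s3 <= s1 + s2. *)
assert (sqrt (ev norm2E z) = s1 + s2 + s3 /\
  sqrt (ev norm2E w) = if Rlt_dec (s1 + s2) s3 then s3 - s1 - s2 else 0) as [Ez Ew].
{ pose proof (sqrt_pos (ev norm2E w)).
  destruct (Nge w) as [Nw | Nw].
  - destruct (vw Nw), vz, (Rlt_dec (s1 + s2) s3); split; lra.
  - assert (s3 <= s1 + s2).
    { apply (vanishing_state c0 c1 c2 r1 r2 r3 s1 s2 s3 w); trivial; lra. }
    rewrite <- Nw, sqrt_0 in *.
    destruct vz, (Rlt_dec (s1 + s2) s3); split; lra. }
rewrite <- Ez, <- Ew; split; split.
- intros y (x & t & ->); rewrite HN; apply sqrt_le_1_alt, Mz.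
- intros b Hb.
  assert (forall x t, sqrt (ev norm2E (state D x t)) <= b) as le
    by (intros; rewrite <- HN; apply Hb; eauto).
  assert (0 <= b) as bp by (eapply Rle_trans; [apply sqrt_pos | apply (le 0 0)]).
  (* The bound is squared to become polynomial in the state, and so passes to the limit state. *)
  rewrite <- (sqrt_pow2 b bp); apply sqrt_le_1_alt.
  apply (limit_le (state D)); trivial; intros x t.
  rewrite <- (pow2_sqrt _ (Nge (state D x t))).
  apply pow_incr; split; [apply sqrt_pos | apply le].
- intros y (x & t & ->); rewrite HN; apply sqrt_le_1_alt, mw.
- intros b Hb.
  assert (forall x t, b <= sqrt (ev norm2E (state D x t))) as le
    by (intros; rewrite <- HN; apply Hb; eauto).
  destruct (Rle_or_lt b 0) as [|bp]; [pose proof (sqrt_pos (ev norm2E w)); lra|].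
  rewrite <- (sqrt_pow2 b) by lra; apply sqrt_le_1_alt.
  assert (ev (PC (-1) * norm2E)%P w <= - b ^ 2) as I; [|cbn [ev] in I; lra].
  apply (limit_le (state D)); trivial; intros x t; cbn [ev].
  assert (b ^ 2 <= ev norm2E (state D x t)); [|lra].
  rewrite <- (pow2_sqrt _ (Nge (state D x t))).
  apply pow_incr; split; [lra | apply le].
Qed.
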